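(* Let $T$ be a complete dependent theory with monster model $\mathfrak{C}$, and let $A\subseteq\mathfrak{C}$ be a (small) set. (i) Let $I$ be an indiscernible sequence over $A$ and let $p,q$ be global types (complete types over $\mathfrak{C}$) both extending $\mathrm{Av}(I,A\cup I)$ and both not forking over $A$. Then $p=q$. (ii) Let $I$ be a Morley sequence over $A$. Then there exists a unique global type which extends $\mathrm{Av}(I,A\cup I)$ and does not fork over $A$. (In other words, $\mathrm{Av}(I,A\cup I)$ is stationary over $A$.)
   Context: Setting: $T$ is a complete theory (classical first-order, or continuous), $T=T^{eq}$, with monster model $\mathfrak{C}$; elements and finite tuples are not distinguished, and all sets are small subsets of $\mathfrak{C}$. $T$ is dependent: for every indiscernible sequence $\langle a_i:i<\lambda\rangle$, every formula $\varphi(x,y)$ and every $c$, the limit $\lim_{i<\lambda}\varphi(a_i,c)$ of truth values exists (classically: the truth value is eventually constant). A formula with parameters stands for its truth value. Conventions: all indiscernible sequences $I=\langle a_i:i\in O\rangle$ are indexed by infinite linear orders without a last element. $a_{<i}$ denotes $\langle a_j:j<i\rangle$. For an indiscernible sequence $I$ and a set $B$, the average type $\mathrm{Av}(I,B)$ is the complete type over $B$ in which each formula $\varphi(x,b)$ over $B$ has the value $\lim_{i}\varphi(a_i,b)$ (limit towards the end of $I$). A Morley (nonforking) sequence over $A$ is an $A$-indiscernible sequence $\langle a_i:i\in O\rangle$ such that $\mathrm{tp}(a_i/Aa_{<i})$ does not fork over $A$ for all $i\in O$. *)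

(* Defs.v *)
From HB Require Import structures.
From mathcomp Require Import all_boot all_order all_algebra.
From mathcomp Require Import all_classical all_reals all_analysis.

Set Implicit Arguments.
Unset Strict Implicit.
Unset Printing Implicit Defensive.

Import Order.TTheory GRing.Theory Num.Theory.
Import numFieldNormedType.Exports.

Local Open Scope classical_set_scope.
Local Open Scope card_scope.
Local Open Scope ring_scope.

(* A context is a finite family of sorted variables: "finite tuple" means an
   environment on some context. Disjoint unions of contexts play the role of
   the juxtaposition x y of two tuples of variables. *)
Record ctx (S : Type) := Ctx { cvar :> finType; csort : cvar -> S }.

Definition ctx0 (S : Type) : ctx S :=
  @Ctx S void (fun x => match x with end).

Definition ctx1 (S : Type) (s : S) : ctx S := @Ctx S unit (fun _ => s).

Definition ctx_cat (S : Type) (X Y : ctx S) : ctx S :=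
  @Ctx S (X + Y)%type
    (fun z => match z with inl x => csort x | inr y => csort y end).

Definition ctx_add (S : Type) (s : S) (X : ctx S) : ctx S :=
  @Ctx S (option X) (fun z => match z with None => s | Some x => csort x end).

Definition ctx_pow (S : Type) (n : nat) (X : ctx S) : ctx S :=
  @Ctx S ('I_n * X)%type (fun z => csort z.2).

Section Environments.
Variables (S : Type) (E : S -> Type).

Definition env (X : ctx S) : Type := forall x : X, E (csort x).

Definition env0 : env (ctx0 S) := fun x => match x with end.

Definition env1 (s : S) (e : E s) : env (ctx1 s) := fun _ => e.

Definition env_cat (X Y : ctx S) (a : env X) (b : env Y) : env (ctx_cat X Y) :=
  fun z => match z with inl x => a x | inr y => b y end.

Definition env_add (s : S) (X : ctx S) (e : E s) (a : env X) :
    env (ctx_add s X) :=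
  fun z => match z with None => e | Some x => a x end.

Definition env_pow (n : nat) (X : ctx S) (a : 'I_n -> env X) :
    env (ctx_pow n X) :=
  fun z => a z.1 z.2.

(* Sets of elements of a many-sorted structure are sets of pairs (s, e). *)
Definition element := {s : S & E s}.

Definition env_in (B : set element) (X : ctx S) (b : env X) : Prop :=
  forall x : X, B (existT E (csort x) (b x)).

End Environments.

Definition card_lt (T U : Type) (A : set T) (B : set U) : Prop :=
  (A #<= B) && ~~ (B #<= A).

(* A type K stands for the cardinal kappa = |K|. *)
Definition small (K T : Type) (B : set T) : Prop := card_lt B [set: K].

(* A structure together with its formulas and their truth values. It is
   instantiated twice: by classical structures (values in the discrete space
   bool) and by metric structures (real values). *)
Record semantics := Semantics {
  esort : Type;
  elt : esort -> Type;
  value : ptopologicalType;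
  true_value : value;
  fml : ctx esort -> Type;
  eval : forall X : ctx esort, fml X -> env elt X -> value }.

Section ModelTheory.
Variables (K : Type) (C : semantics).

Local Notation context := (ctx (esort C)).
Local Notation tuple X := (env (@elt C) X).
Local Notation pt := (element (@elt C)).

(* An assignment of a truth value to every formula phi(x, b) with parameters.
   A type over B is such an assignment, of which only the values at the
   formulas over B matter. *)
Definition pretype (X : context) : Type :=
  forall Y : context, fml (ctx_cat X Y) -> tuple Y -> value C.

Definition tp (X : context) (a : tuple X) : pretype X :=
  fun Y phi b => eval phi (env_cat a b).

Definition agree_on (B : set pt) (X : context) (p q : pretype X) : Prop :=
  forall (Y : context) (phi : fml (ctx_cat X Y)) (b : tuple Y),
    env_in B b -> p Y phi b = q Y phi b.

(* Complete types over B: the assignments that are (approximately) finitely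
   satisfiable. For discrete values this is exact finite satisfiability. *)
Definition complete_type (B : set pt) (X : context) (p : pretype X) : Prop :=
  forall (n : nat) (Y : 'I_n -> context)
         (phi : forall k, fml (ctx_cat X (Y k))) (b : forall k, tuple (Y k))
         (U : 'I_n -> set (value C)),
    (forall k, env_in B (b k)) ->
    (forall k, nbhs (p (Y k) (phi k) (b k)) (U k)) ->
    exists a : tuple X, forall k, U k (eval (phi k) (env_cat a (b k))).

Definition global_type (X : context) (p : pretype X) : Prop :=
  complete_type [set: pt] p.

Definition saturated : Prop :=
  forall (B : set pt) (X : context) (p : pretype X),
    small K B -> complete_type B p ->
    exists a : tuple X, agree_on B (tp a) p.

Definition elementary_on (B : set pt) (f : forall s, @elt C s -> @elt C s) :
    Prop :=
  forall (X : context) (phi : fml X) (a : tuple X),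
    env_in B a -> eval phi (fun x => f _ (a x)) = eval phi a.

Definition homogeneous
    (automorphism : (forall s, @elt C s -> @elt C s) -> Prop) : Prop :=
  forall (B : set pt) (f : forall s, @elt C s -> @elt C s),
    small K B -> elementary_on B f ->
    exists2 g, automorphism g &
      forall (s : esort C) (e : @elt C s), B (existT _ s e) -> g s e = f s e.

(* T = T^eq: every formula phi(x, y) has a sort of canonical parameters, i.e.
   the instances phi(x, b) are exactly the instances chi(x, c) of a formula
   whose parameter c ranges over a single sort and is determined by the
   function x |-> chi(x, c). For phi an equivalence relation, c is the class
   of b. *)
Definition has_canonical_parameters : Prop :=
  forall (X Y : context) (phi : fml (ctx_cat X Y)),
    exists (s : esort C) (chi : fml (ctx_cat X (ctx1 s))),
      [/\ forall b : tuple Y, exists c : @elt C s, forall a : tuple X,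
            eval phi (env_cat a b) = eval chi (env_cat a (env1 c)),
          forall c : @elt C s, exists b : tuple Y, forall a : tuple X,
            eval chi (env_cat a (env1 c)) = eval phi (env_cat a b)
        & forall c c' : @elt C s,
            (forall a : tuple X,
              eval chi (env_cat a (env1 c)) = eval chi (env_cat a (env1 c'))) ->
            c = c'].

Section Sequences.
Variables (d : Order.disp_t) (O : orderType d) (X : context).

(* Nonempty without a last element, hence infinite. *)
Definition endless : Prop :=
  (exists i : O, True) /\ (forall i : O, exists j : O, (i < j)%O).

Definition tail_filter : set_system O :=
  filter_from [set: O] (fun i => [set j | (i <= j)%O]).

(* The set of all coordinates of the a_i for i in D. *)
Definition entries (I : O -> tuple X) (D : set O) : set pt :=
  [set e | exists i x, D i /\ e = existT _ (csort x) (I i x)].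

Definition indiscernible (A : set pt) (I : O -> tuple X) : Prop :=
  forall (n : nat) (Y : context) (phi : fml (ctx_cat (ctx_pow n X) Y))
         (a : tuple Y) (i j : 'I_n -> O),
    env_in A a ->
    (forall k l : 'I_n, (k < l)%N -> (i k < i l)%O) ->
    (forall k l : 'I_n, (k < l)%N -> (j k < j l)%O) ->
    eval phi (env_cat (env_pow (fun k => I (i k))) a) =
    eval phi (env_cat (env_pow (fun k => I (j k))) a).

(* The average type; over B it is Av(I, B), up to [agree_on B]. *)
Definition Av (I : O -> tuple X) : pretype X :=
  fun Y phi b =>
    lim ((fun i => eval phi (env_cat (I i) b)) @ tail_filter).

End Sequences.

(* Limit ordinals are the endless well-orders. *)
Definition dependent : Prop :=
  forall (d : Order.disp_t) (O : orderType d) (X Y : context)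
         (I : O -> tuple X) (phi : fml (ctx_cat X Y)) (c : tuple Y),
    endless O -> well_founded (fun i j : O => (i < j)%O) ->
    small K (entries I setT) -> indiscernible set0 I ->
    cvg ((fun i => eval phi (env_cat (I i) c)) @ @tail_filter d O).

(* phi(x, b) divides over A. Countable sets being small, inconsistency is
   tested in the monster model. *)
Definition divides (A : set pt) (X Y : context) (phi : fml (ctx_cat X Y))
    (b : tuple Y) : Prop :=
  exists J : nat -> tuple Y,
    [/\ indiscernible A J, J 0%N = b
      & ~ exists a : tuple X,
            forall i, eval phi (env_cat a (J i)) = true_value C].

(* The type p over B forks over A: it implies a finite disjunction of formulas
   that divide over A. Implication is tested on global completions of p, since
   p itself may be global and hence not realised. *)
Definition forks (A B : set pt) (X : context) (p : pretype X) : Prop :=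
  exists (n : nat) (Y : 'I_n -> context)
         (phi : forall k, fml (ctx_cat X (Y k))) (b : forall k, tuple (Y k)),
    (forall k, divides A (phi k) (b k)) /\
    (forall q : pretype X, global_type q -> agree_on B q p ->
       exists k, q (Y k) (phi k) (b k) = true_value C).

Definition Morley_sequence (A : set pt) (X : context) (d : Order.disp_t)
    (O : orderType d) (I : O -> tuple X) : Prop :=
  indiscernible A I /\
  forall i : O,
    ~ forks A (A `|` entries I [set j | (j < i)%O]) (tp (I i)).

End ModelTheory.

Record language := Language {
  lsort : Type;
  lfun : Type;
  fdom : lfun -> ctx lsort;
  fcod : lfun -> lsort;
  lrel : Type;
  rdom : lrel -> ctx lsort }.

(* |L| + aleph_0 < kappa *)
Definition language_small (K : Type) (L : language) : Prop :=
  [/\ small K [set: nat], small K [set: lsort L], small K [set: lfun L]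
    & small K [set: lrel L]].

Inductive term (L : language) (X : ctx (lsort L)) : lsort L -> Type :=
| Var (x : X) : term X (csort x)
| App (f : lfun L) (t : forall i : fdom f, term X (csort i)) :
    term X (fcod f).

Section Evaluation.
Variables (L : language) (E : lsort L -> Type).
Variable (fint : forall f : lfun L, env E (fdom f) -> E (fcod f)).

Fixpoint term_eval (X : ctx (lsort L)) (a : env E X) (s : lsort L)
    (t : term X s) : E s :=
  match t in term _ s0 return E s0 with
  | Var x => a x
  | App f u => fint (fun i => term_eval a (u i))
  end.

End Evaluation.

(* Automorphisms, for relations with values in any type V. *)
Definition preserves_symbols (L : language) (V : Type) (E : lsort L -> Type)
    (fint : forall f : lfun L, env E (fdom f) -> E (fcod f))
    (rint : forall r : lrel L, env E (rdom r) -> V)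
    (g : forall s, E s -> E s) : Prop :=
  [/\ forall s, bijective (g s),
      forall f a, g _ (fint f a) = fint f (fun i => g _ (a i))
    & forall r a, rint r (fun i => g _ (a i)) = rint r a].

Inductive formula (L : language) (X : ctx (lsort L)) : Type :=
| FRel (r : lrel L) (t : forall i : rdom r, term X (csort i))
| FEq (s : lsort L) (t u : term X s)
| FBot
| FImp (phi psi : formula X)
| FAll (s : lsort L) (phi : formula (ctx_add s X)).

Arguments FBot {L X}.

Record structure (L : language) := Structure {
  carrier : lsort L -> Type;
  carrier_inhabited : forall s, inhabited (carrier s);
  fint : forall f : lfun L, env carrier (fdom f) -> carrier (fcod f);
  rint : forall r : lrel L, env carrier (rdom r) -> bool }.

Fixpoint feval (L : language) (M : structure L) (X : ctx (lsort L))
    (phi : formula X) : env (@carrier L M) X -> bool :=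
  match phi with
  | FRel r t => fun a => rint (fun i => term_eval (@fint L M) a (t i))
  | FEq s t u => fun a =>
      `[< term_eval (@fint L M) a t = term_eval (@fint L M) a u >]
  | FBot => fun _ => false
  | FImp phi psi => fun a => feval phi a ==> feval psi a
  | FAll s phi => fun a =>
      `[< forall e : carrier M s, feval phi (env_add e a) >]
  end.

Definition classical (L : language) (M : structure L) : semantics :=
  @Semantics (lsort L) (@carrier L M) bool true (@formula L) (@feval L M).

Definition theory (L : language) := set (formula (ctx0 (lsort L))).

Definition satisfies (L : language) (M : structure L)
    (sigma : formula (ctx0 (lsort L))) : Prop :=
  feval sigma (env0 (@carrier L M)).

Definition models (L : language) (M : structure L) (T : theory L) : Prop :=
  forall sigma, T sigma -> satisfies M sigma.

Definition complete_theory (L : language) (T : theory L) : Prop :=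
  (exists M : structure L, models M T) /\
  forall sigma, (forall M, models M T -> satisfies M sigma) \/
                (forall M, models M T -> satisfies M (FImp sigma FBot)).

Definition automorphism (L : language) (M : structure L)
    (g : forall s, carrier M s -> carrier M s) : Prop :=
  preserves_symbols (@fint L M) (@rint L M) g.

Section Continuous.
Variable R : realType.

Definition unit_cube (n : nat) : set 'rV[R]_n :=
  [set v | forall i, 0 <= v ord0 i <= 1].

Definition connective (n : nat) (u : 'rV[R]_n -> R) : Prop :=
  {within @unit_cube n, continuous u} /\
  (forall v, unit_cube v -> 0 <= u v <= 1).

(* The language provides the moduli of uniform continuity of its symbols. *)
Record metric_language := MetricLanguage {
  mlang :> language;
  fmod : lfun mlang -> R -> R;
  rmod : lrel mlang -> R -> R;
  fmod_gt0 : forall f e, 0 < e -> 0 < fmod f e;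
  rmod_gt0 : forall r e, 0 < e -> 0 < rmod r e }.

Inductive mformula (L : metric_language) (X : ctx (lsort L)) : Type :=
| MRel (r : lrel L) (t : forall i : rdom r, term X (csort i))
| MDist (s : lsort L) (t u : term X s)
| MConn (n : nat) (u : 'rV[R]_n -> R) (hu : connective u)
    (phi : 'I_n -> mformula X)
| MSup (s : lsort L) (phi : mformula (ctx_add s X))
| MInf (s : lsort L) (phi : mformula (ctx_add s X)).

Record metric_structure (L : metric_language) := MetricStructure {
  mcarrier : lsort L -> metricType R;
  mcarrier_inhabited : forall s, inhabited (mcarrier s);
  mcarrier_complete : forall s (F : set_system (mcarrier s)),
    ProperFilter F -> cauchy F -> exists x : mcarrier s, F --> x;
  mcarrier_bounded : forall s (x y : mcarrier s), mdist x y <= 1;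
  mfint : forall f : lfun L, env mcarrier (fdom f) -> mcarrier (fcod f);
  mrint : forall r : lrel L, env mcarrier (rdom r) -> R;
  mfint_modulus : forall f (e : R) (a b : env mcarrier (fdom f)),
    0 < e -> (forall i, mdist (a i) (b i) < fmod f e) ->
    mdist (mfint a) (mfint b) <= e;
  mrint_modulus : forall r (e : R) (a b : env mcarrier (rdom r)),
    0 < e -> (forall i, mdist (a i) (b i) < rmod r e) ->
    `|mrint a - mrint b| <= e;
  mrint_bounded : forall r (a : env mcarrier (rdom r)), 0 <= mrint a <= 1 }.

Fixpoint mfeval (L : metric_language) (M : metric_structure L)
    (X : ctx (lsort L)) (phi : mformula X) :
    env (fun s => mcarrier M s : Type) X -> R :=
  match phi with
  | MRel r t => fun a => mrint (fun i => term_eval (@mfint L M) a (t i))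
  | MDist s t u => fun a =>
      mdist (term_eval (@mfint L M) a t) (term_eval (@mfint L M) a u)
  | MConn n u _ phi => fun a => u (\row_i mfeval (phi i) a)
  | MSup s phi => fun a =>
      sup [set mfeval phi (env_add e a) | e in [set: mcarrier M s]]
  | MInf s phi => fun a =>
      inf [set mfeval phi (env_add e a) | e in [set: mcarrier M s]]
  end.

(* The value 0 is "true". *)
Definition continuous_semantics (L : metric_language) (M : metric_structure L) :
    semantics :=
  @Semantics (lsort L) (fun s => mcarrier M s : Type) R 0
    (@mformula L) (@mfeval L M).

(* A set of sentences sigma stands for the set of conditions sigma = 0. *)
Definition mtheory (L : metric_language) := set (mformula (ctx0 (lsort L))).

Definition mvalue (L : metric_language) (M : metric_structure L)
    (sigma : mformula (ctx0 (lsort L))) : R :=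
  mfeval sigma (env0 (fun s => mcarrier M s : Type)).

Definition mmodels (L : metric_language) (M : metric_structure L)
    (T : mtheory L) : Prop :=
  forall sigma, T sigma -> mvalue M sigma = 0.

Definition complete_mtheory (L : metric_language) (T : mtheory L) : Prop :=
  (exists M : metric_structure L, mmodels M T) /\
  forall sigma, exists r : R,
    forall M : metric_structure L, mmodels M T -> mvalue M sigma = r.

Definition mautomorphism (L : metric_language) (M : metric_structure L)
    (g : forall s, (mcarrier M s : Type) -> (mcarrier M s : Type)) : Prop :=
  preserves_symbols (@mfint L M) (@mrint L M) g /\
  forall s (x y : mcarrier M s), mdist (g s x) (g s y) = mdist x y.

End Continuous.

(* [monster_model R K C]: C is a monster model of a complete theory T,
   classical or continuous: it is |K|-saturated and strongly |K|-homogeneous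
   for a cardinal |K| > |T|, and "small" means of cardinality < |K|. *)
Inductive monster_model (R : realType) (K : Type) : semantics -> Prop :=
| classical_monster (L : language) (T : theory L) (M : structure L) :
    language_small K L -> complete_theory T -> models M T ->
    saturated K (classical M) ->
    @homogeneous K (classical M) (@automorphism L M) ->
    monster_model R K (classical M)
| continuous_monster (L : metric_language R) (T : mtheory L)
    (M : metric_structure L) :
    language_small K L -> complete_mtheory T -> mmodels M T ->
    saturated K (continuous_semantics M) ->
    @homogeneous K (continuous_semantics M) (@mautomorphism R L M) ->
    monster_model R K (continuous_semantics M).

(* Main.v *)
(** In a dependent theory a global type [p] that does not fork over [A] takes
    the same value at the first two terms of any [A]-indiscernible sequence [J]:
    otherwise the condition "[phi(x, J_0)] and [phi(x, J_1)] have different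
    values" divides over [A], since by dependence no element satisfies it along
    the pairs [(J_2k, J_2k+1)].

    For (i), suppose that [p] and [q] differ at [phi(x, b)]. Let [c_n] realise
    alternately [p] and [q] over [A], [I], [b] and the earlier [c_k]. By induction
    [I] followed by [c_0, c_1, ...] is [A]-indiscernible: after moving
    [c_0, ..., c_(n-1)] into [I] by an automorphism over [A], invariance along
    indiscernible sequences together with [p] extending the average type
    determine the type of [c_n]. Then [phi(c_n, b)] oscillates.

    For (ii), an ultrafilter yields a global type satisfying all conditions of
    the average type and avoiding neighbourhoods of all dividing conditions.
    Finitely many of these have a common solution, because a late term of the
    Morley sequence satisfies the average conditions involved and its type over
    the earlier terms does not fork over [A]. *)
Require Import Defs.
From HB Require Import structures.
From mathcomp Require Import all_boot all_order all_algebra.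
From mathcomp Require Import all_classical all_reals all_analysis.
From mathcomp Require Import zify.

Set Implicit Arguments.
Unset Strict Implicit.
Unset Printing Implicit Defensive.

Import Order.TTheory GRing.Theory Num.Theory.
Import numFieldNormedType.Exports.

Local Open Scope classical_set_scope.
Local Open Scope card_scope.

(* Evaluation of continuous functions in MathComp-Analysis has the same name. *)
Local Notation eval := Defs.eval.

(** * Cardinalities *)

(** Choice turns a total relation in which no two elements share a value into an injection.
    Relations are easier to define by cases than functions between subtypes. *)
Lemma card_le_relP (T U : Type) (A : set T) (B : set U) :
  A #<= B <-> exists r : T -> U -> Prop,
    (forall x, A x -> exists2 y, B y & r x y) /\
    (forall x x' y, A x -> A x' -> r x y -> r x' y -> x = x').
Proof.
split=> [/card_leP[f]|[r [rtot rinj]]].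
  exists (fun x y => exists2 x' : A, val x' = x & val (f x') = y); split.
    move=> x Ax; pose x' : A := SigSub (mem_set Ax).
    exists (val (f x')); last by exists x'.
    exact: set_mem (valP (f x')).
  move=> x x' y Ax Ax' [a <- <-] [a' <-] /val_inj.
  by move=> /(@inj _ _ _ f) ->; rewrite ?in_setT.
have /choice[f fP] : forall x : A, exists y : B, r (val x) (val y).
  move=> x; have [y By rxy] := rtot _ (set_mem (valP x)).
  by exists (SigSub (mem_set By)).
apply/card_leP/injfunPex; exists f => // x x' _ _ fxx'.
apply/val_inj; have := fP x'; rewrite -fxx'.
by apply: rinj (fP x); exact: set_mem (valP _).
Qed.

(** By Zorn there is a maximal partial matching of [A] with [B]; if it left out an element on both
    sides, that pair could be added. *)
Lemma card_le_total (T U : Type) (A : set T) (B : set U) :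
  A #<= B \/ B #<= A.
Proof.
pose P (r : set (T * U)) := [/\ forall z, r z -> A z.1 /\ B z.2,
  forall x x' y, r (x, y) -> r (x', y) -> x = x' &
  forall x y y', r (x, y) -> r (x, y') -> y = y'].
have [F FP Ftot|r [[rAB rinj rfun] rmax]] := @Zorn_bigcup _ P.
  split=> [z [r /FP[rAB _ _]]|x x' y [r Fr rxy] [r' Fr' rxy']|
           x y y' [r Fr rxy] [r' Fr' rxy']]; first exact: rAB.
  - have [/FP[_ rinj _] /FP[_ rinj' _]] := (Fr, Fr').
    by have [/(_ _ rxy) rxy2|/(_ _ rxy') rxy2] := Ftot _ _ Fr Fr';
      [exact: rinj' rxy2 rxy'|exact: rinj rxy rxy2].
  - have [/FP[_ _ rfun] /FP[_ _ rfun']] := (Fr, Fr').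
    by have [/(_ _ rxy) rxy2|/(_ _ rxy') rxy2] := Ftot _ _ Fr Fr';
      [exact: rfun' rxy2 rxy'|exact: rfun rxy rxy2].
have [Atot|nA] := pselect (forall x, A x -> exists2 y, B y & r (x, y)).
  left; apply/card_le_relP; exists (fun x y => r (x, y)); split=> // x x' y _ _.
  exact: rinj.
right; apply/card_le_relP; exists (fun y x => r (x, y)).
split=> [y By|y y' x _ _]; last exact: rfun.
apply: contrapT => ny; apply: nA => x Ax; apply: contrapT => nx.
have nx' y' : ~ r (x, y').
  by move=> rxy; apply: nx; exists y' => //; have [] := rAB _ rxy.
have ny' x' : ~ r (x', y).
  by move=> rxy; apply: ny; exists x' => //; have [] := rAB _ rxy.
apply: (rmax (r `|` [set (x, y)])).
  by split=> [z|/(_ (x, y) (or_intror erefl)) /nx' //]; left.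
split=> [z [/rAB//|-> //]|a a' b [rab|[ea eb]] [rab'|[ea' eb']]|
         a b b' [rab|[ea eb]] [rab'|[ea' eb']]].
- exact: rinj rab rab'.
- by case: (ny' a); rewrite -eb'.
- by case: (ny' a'); rewrite -eb.
- by rewrite ea.
- exact: rfun rab rab'.
- by case: (nx' b); rewrite -ea'.
- by case: (nx' b'); rewrite -ea.
- by rewrite eb.
Qed.

(* By Zorn, all but finitely many elements of an infinite set are covered by
   disjoint countable sequences; each of them has room for two copies of itself
   and for the remainder. *)
Lemma card_le_double (T : Type) (A : set T) :
  infinite_set A -> A `*` [set: bool] #<= A.
Proof.
move=> Ainf.
pose P (F : set (nat -> T)) := (forall s, F s -> forall n, A (s n)) /\
  forall s s' n n', F s -> F s' -> s n = s' n' -> s = s' /\ n = n'.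
have [F FP Ftot|F [[FA Finj] Fmax]] := @Zorn_bigcup _ P.
  split=> [s [S /FP[SA _]]|s s' n n' [S FS Ss] [S' FS' Ss']]; first exact: SA.
  have [/FP[_ Sinj] /FP[_ S'inj]] := (FS, FS').
  by have [/(_ _ Ss) Ss2|/(_ _ Ss') Ss2] := Ftot _ _ FS FS';
    [exact: S'inj|exact: Sinj].
pose B := A `&` [set x | forall s n, F s -> s n <> x].
have Bfin : finite_set B.
  apply: contrapT => /infiniteP/card_le_relP[r [rtot rinj]].
  have /choice[s sP] n : exists x, B x /\ r n x.
    by have [x ? ?] := rtot n I; exists x.
  have sB n : B (s n) by have [] := sP n.
  have sinj n n' : s n = s n' -> n = n'.
    move=> E; have [_ rn] := sP n; have [_ rn'] := sP n'.
    by apply: rinj rn _ => //; rewrite E.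
  apply: (Fmax (F `|` [set s])).
    split=> [z|/(_ s (or_intror erefl)) Fs]; first by left.
    by have [_ /(_ s 0%N Fs)] := sB 0%N.
  split=> [t [/FA//|-> n]|t t' n n' [Ft|->] [Ft'|->] E].
  - by have [] := sB n.
  - exact: Finj.
  - by have [_ /(_ _ _ Ft)/(_ E)] := sB n'.
  - by have [_ /(_ _ _ Ft')] := sB n; rewrite E => /(_ n').
  - by split=> //; exact: sinj.
have [s0 Fs0] : exists s, F s.
  apply: contrapT => nF; apply: Ainf; suff -> : A = B by [].
  apply/seteqP; split=> [x Ax|x []//]; split=> // s n Fs.
  by case: nF; exists s.
have /card_le_relP[r [rtot rinj]] : B #<= [set: nat].
  exact: finite_set_countable.
apply/card_le_relP.
(* The tag 0 or 1 in the code separates the copies of the terms of [s0] from the remainder [B],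
   which is also stored in [s0]. *)
exists (fun (z : T * bool) y => exists n : nat,
  (exists2 s, F s & s n = z.1 /\ y = s (pickle (0%N, n, z.2))) \/
  [/\ B z.1, r z.1 n & y = s0 (pickle (1%N, n, z.2))]); split.
  move=> [x e] [/= Ax _]; have [Bx|nB] := pselect (B x).
    have [n _ rxn] := rtot _ Bx.
    exists (s0 (pickle (1%N, n, e))); first exact: FA.
    by exists n; right.
  have [s [n [Fs snx]]] : exists s n, F s /\ s n = x.
    by apply: contrapT => h; apply: nB; split=> // s n Fs snx; apply: h; exists s, n.
  exists (s (pickle (0%N, n, e))); first exact: FA.
  by exists n; left; exists s.
move=> [x e] [x' e'] y _ _ [n [[s Fs /= [<- ->]]|/= [Bx rx ->]]]
  [n' [[s' Fs' [<-]]|[Bx' rx']]] E.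
- by have [<- /(pcan_inj pickleK)[-> ->]] := Finj _ _ _ _ Fs Fs' E.
- by have [_ /(pcan_inj pickleK)[]] := Finj _ _ _ _ Fs Fs0 E.
- by have [_ /(pcan_inj pickleK)[]] := Finj _ _ _ _ Fs0 Fs' E.
- have [_ /(pcan_inj pickleK)[en ->]] := Finj _ _ _ _ Fs0 Fs0 E.
  by rewrite (rinj _ _ _ Bx Bx' rx) // en.
Qed.

(** Two copies of [B] fit into [B]: one receives [A], the other [B] itself. *)
Lemma card_le_setU (T : Type) (A B : set T) :
  infinite_set B -> A #<= B -> A `|` B #<= B.
Proof.
move=> /card_le_double BB /card_le_relP[r [rtot rinj]].
apply: card_le_trans BB; apply/card_le_relP.
exists (fun x (z : T * bool) => if z.2 then x = z.1 else A x /\ r x z.1).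
split=> [x [Ax|Bx]|x x' [y []] _ _ /=].
- by have [y By rxy] := rtot _ Ax; exists (y, false).
- by exists (x, true).
- by move=> -> ->.
- by move=> [Ax rx] [Ax' rx']; exact: rinj rx rx'.
Qed.

(** * Elementary relations *)

Section Coordinates.
Variable C : semantics.
Local Notation tuple X := (env (@elt C) X).
Local Notation pt := (element (@elt C)).

Definition coord (X : ctx (esort C)) (a : tuple X) (x : X) : pt :=
  existT _ (csort x) (a x).

(** The graph of a partial elementary map. A relation on sorted elements can be given by cases
    without transport between sorts. *)
Definition elementary_rel (r : pt -> pt -> Prop) : Prop :=
  forall (X : ctx (esort C)) (phi : fml X) (a a' : tuple X),
    (forall x, r (coord a x) (coord a' x)) -> eval phi a = eval phi a'.

Definition order_iso (d : Order.disp_t) (O : orderType d)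
    (o : O -> O -> Prop) : Prop :=
  forall i i' k k', o i i' -> o k k' -> (i < k)%O = (i' < k')%O.

(** Indiscernibility over [A] is used in this form: fixing [A] and moving the terms of [J] along a
    partial order isomorphism is elementary. *)
Definition shift (A : set pt) (d : Order.disp_t) (O : orderType d)
    (X : ctx (esort C)) (J : O -> tuple X) (o : O -> O -> Prop) (u v : pt) :=
  (A u /\ u = v) \/
  exists i i' x, [/\ o i i', u = coord (J i) x & v = coord (J i') x].

Lemma coord_transport (X : ctx (esort C)) (s : esort C) (x : X) :
  csort x = s -> forall a : tuple X, exists e : elt s, existT _ s e = coord a x.
Proof. by move=> <- a; exists (a x). Qed.

Lemma coord_inj (X : ctx (esort C)) (a a' : tuple X) :
  (forall x, coord a x = coord a' x) -> a = a'.
Proof.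
move=> aa'; apply: functional_extensionality_dep => x.
exact: (@existT_inj2 {classic esort C} _ _ _ _ (aa' x)).
Qed.
End Coordinates.

(* What the proof uses of a monster model, classical or continuous. In
   [tame_approx], [psi n] is [phi] itself in the classical case and
   [max(0, phi - 1/(n+1))] in the continuous one. *)
Record tame (K : Type) (C : semantics) : Prop := {
  tame_rename : forall (X Y : ctx (esort C)) (phi : fml X) (m : X -> Y),
    (forall x, csort (m x) = csort x) ->
    exists psi : fml Y, forall (a : env (@elt C) X) (b : env (@elt C) Y),
      (forall x, coord a x = coord b (m x)) -> eval psi b = eval phi a;
  tame_eq : forall s : esort C, exists delta : fml (ctx_cat (ctx1 s) (ctx1 s)),
    forall e e' e'' : elt s,
      eval delta (env_cat (env1 e) (env1 e)) =
      eval delta (env_cat (env1 e') (env1 e'')) -> e' = e'';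
  tame_homogeneous : forall (B : set (element (@elt C)))
      (f : forall s, @elt C s -> @elt C s),
    small K B -> elementary_on B f ->
    exists g g' : forall s, @elt C s -> @elt C s,
      [/\ forall s, cancel (g s) (g' s), forall s, cancel (g' s) (g s),
          elementary_on setT g &
          forall s e, B (existT _ s e) -> g s e = f s e];
  tame_saturated : saturated K C;
  tame_small_nat : small K [set: nat];
  tame_hausdorff : hausdorff_space (value C);
  tame_ultra : forall (T : Type) (F : set_system T), UltraFilter F ->
    forall (X : ctx (esort C)) (phi : fml X) (a : T -> env (@elt C) X),
      cvg ((fun t => eval phi (a t)) @ F);
  tame_separate : forall v w : value C, v <> w ->
    exists h : value C * value C -> value C,
      [/\ continuous h, h (v, w) = true_value C,
          forall l, h (l, l) <> true_value C &
          forall (X : ctx (esort C)) (phi phi' : fml X), exists psi : fml X,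
            forall a, eval psi a = h (eval phi a, eval phi' a)];
  tame_approx : forall (X : ctx (esort C)) (phi : fml X),
    exists psi : nat -> fml X,
      (forall n, exists2 N, nbhs (true_value C) N &
        forall a, N (eval phi a) -> eval (psi n) a = true_value C) /\
      (forall U, nbhs (true_value C) U -> exists n, forall m, (n <= m)%N ->
        forall a, eval (psi m) a = true_value C -> U (eval phi a)) }.

Section Elementary.
Variables (K : Type) (C : semantics) (tameC : tame K C).
Local Notation tuple X := (env (@elt C) X).
Local Notation pt := (element (@elt C)).

Definition ctx_sub (X : ctx (esort C)) (P : pred X) : ctx (esort C) :=
  @Ctx _ {x : X | P x} (fun x => csort (val x)).

Definition env_sub (X : ctx (esort C)) (P : pred X) (a : tuple X) :
  tuple (ctx_sub P) := fun x => a (val x).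
Arguments env_sub {X} P a.

(** Every pair of coordinates comes from [r] or from [c] and [c'], so a renaming of variables turns
    any formula into one in the variables of [c] and parameters moved by [r]. *)
Lemma elementary_relU (X : ctx (esort C)) (c c' : tuple X)
    (r : pt -> pt -> Prop) :
  (forall (Y : ctx (esort C)) (phi : fml (ctx_cat X Y)) (b b' : tuple Y),
    (forall y, r (coord b y) (coord b' y)) ->
    eval phi (env_cat c b) = eval phi (env_cat c' b')) ->
  elementary_rel (fun u v => r u v \/
    exists x, u = coord c x /\ v = coord c' x).
Proof.
move=> H Z phi a a' aa'.
pose P := [pred z : Z | `[< r (coord a z) (coord a' z) >]].
pose Q z (w : X + {z | P z}) : Prop :=
  match w with
  | inl x => coord a z = coord c x /\ coord a' z = coord c' x
  | inr z' => val z' = z end.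
have /choice[m mP] z : exists w, Q z w.
  have [Pz|nPz] := boolP (P z); first by exists (inr (exist _ z Pz)).
  have [rz|[x [Ex Ex']]] := aa' z; first by case/negP: nPz; apply/asboolP.
  by exists (inl x).
pose m' : Z -> ctx_cat X (ctx_sub P) := m.
have [|psi psiP] := tame_rename tameC phi (m := m').
  move=> z; rewrite /m'; have := mP z; case: (m z) => [x [Ez _]|z' <-//].
  by symmetry; exact: (f_equal (@projT1 _ _) Ez).
rewrite -(psiP a (env_cat c (env_sub P a))) -?(psiP a' (env_cat c' (env_sub P a'))).
- by apply: H => z; have /asboolP := valP z.
- by move=> z; rewrite /m'; have := mP z; case: (m z) => [x [_ ->]//|z' <-].
- by move=> z; rewrite /m'; have := mP z; case: (m z) => [x [-> _]//|z' <-].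
Qed.

(** The pair [(e, e)] is mapped to [(e', e'')], and the formula expressing equality keeps its
    value. *)
Lemma elementary_rel_fun (r : pt -> pt -> Prop) (s : esort C) (e e' e'' : elt s) :
  elementary_rel r ->
  r (existT _ s e) (existT _ s e') -> r (existT _ s e) (existT _ s e'') ->
  e' = e''.
Proof.
move=> er r1 r2; have [delta deltaP] := tame_eq tameC s.
by apply: (deltaP e); apply: er => -[[]|[]].
Qed.

(** A tuple involves only finitely many terms of [J]. Listing their indices in increasing order and
    renaming variables reduces the claim to the definition of indiscernibility. *)
Lemma indiscernible_shift (A : set pt) (d : Order.disp_t) (O : orderType d)
    (X : ctx (esort C)) (J : O -> tuple X) (o : O -> O -> Prop) :
  indiscernible A J -> order_iso o -> elementary_rel (shift A J o).
Proof.
move=> Jind oiso Z phi a a' aa'.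
pose Q z (t : option (O * O * X)) : Prop :=
  match t with
  | None => A (coord a z) /\ coord a z = coord a' z
  | Some (i, i', x) =>
      [/\ o i i', coord a z = coord (J i) x & coord a' z = coord (J i') x] end.
have /choice[t tP] z : exists t, Q z t.
  have [[? ?]|[i [i' [x ?]]]] := aa' z; first by exists None.
  by exists (Some (i, i', x)).
pose P := [pred z : Z | t z == None].
pose s := sort <=%O (undup (pmap (fun z => omap (fun y => y.1.1) (t z)) (enum Z))).
have s_in z i i' x : t z = Some (i, i', x) -> i \in s.
  move=> tz; rewrite mem_sort mem_undup mem_pmap; apply/mapP; exists z.
    by rewrite mem_enum.
  by rewrite tz.
have s_ex i : i \in s -> exists i', o i i'.
  rewrite mem_sort mem_undup mem_pmap => /mapP[z _].
  have := tP z; case: (t z) => // -[[k k'] x] /= [okk' _ _] [->].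
  by exists k'.
have s_lt : sorted <%O s.
  by rewrite sort_lt_sorted undup_uniq.
pose n := size s.
have /choice[f fP] (k : 'I_n) : exists i', o (tnth (in_tuple s) k) i'.
  exact/s_ex/mem_tnth.
have i_lt (k l : 'I_n) : (k < l)%N -> (tnth (in_tuple s) k < tnth (in_tuple s) l)%O.
  move=> kl; have i0 : O by exact: tnth (in_tuple s) k.
  rewrite !(tnth_nth i0) /=.
  by rewrite (sorted_ltn_nth lt_trans) ?inE.
have f_lt (k l : 'I_n) : (k < l)%N -> (f k < f l)%O.
  by move=> /i_lt; rewrite (oiso _ _ _ _ (fP k) (fP l)).
have o_eq i i' i'' : o i i' -> o i i'' -> i' = i''.
  move=> o1 o2; have := oiso _ _ _ _ o1 o2; have := oiso _ _ _ _ o2 o1.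
  by rewrite ltxx; case: ltgtP.
pose R z (w : 'I_n * X + {z | P z}) : Prop :=
  match w with
  | inl (k, x) => coord a z = coord (J (tnth (in_tuple s) k)) x /\
                  coord a' z = coord (J (f k)) x
  | inr z' => val z' = z end.
have /choice[m mP] z : exists w, R z w.
  have [Pz|nPz] := boolP (P z); first by exists (inr (exist _ z Pz)).
  have := tP z; case tz : (t z) => [[[i i'] x]|] /=; last first.
    by case/negP: nPz; rewrite inE tz.
  move=> [oi E E']; have /tnthP[k Ek] : i \in in_tuple s by exact: s_in tz.
  exists (inl (k, x)); split; first by rewrite -Ek.
  by rewrite E' (o_eq _ (f k) i' _ oi) // Ek.
pose m' : Z -> ctx_cat (ctx_pow n X) (ctx_sub P) := m.
have [|psi psiP] := tame_rename tameC phi (m := m').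
  move=> z; rewrite /m'; have := mP z; case: (m z) => [[k x] [Ez _]|z' <-//].
  by symmetry; exact: (f_equal (@projT1 _ _) Ez).
have E0 : env_sub P a = env_sub P a'.
  apply: coord_inj => z; have := tP (val z); have /eqP -> := valP z.
  by case.
rewrite -(psiP a (env_cat (env_pow (fun k => J (tnth (in_tuple s) k))) (env_sub P a))).
  rewrite -(psiP a' (env_cat (env_pow (fun k => J (f k))) (env_sub P a'))).
    rewrite -E0; apply: Jind => // z.
    by have := tP (val z); have /eqP -> := valP z; case.
  by move=> z; rewrite /m'; have := mP z; case: (m z) => [[k x] [_ ->]//|z' <-].
by move=> z; rewrite /m'; have := mP z; case: (m z) => [[k x] [-> _]//|z' <-].
Qed.

Lemma shift_indiscernible (A : set pt) (d : Order.disp_t) (O : orderType d)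
    (X : ctx (esort C)) (J : O -> tuple X) :
  (forall o, order_iso o -> elementary_rel (shift A J o)) -> indiscernible A J.
Proof.
move=> H n Y phi a i j Aa ilt jlt.
have iso : order_iso (fun u v => exists k, u = i k /\ v = j k).
  move=> u u' v v' [k [-> ->]] [l [-> ->]].
  have [kl|lk|/val_inj ->] := ltngtP k l; last by rewrite !ltxx.
    by rewrite ilt // jlt.
  by rewrite !ltNge !ltW ?ilt ?jlt.
apply: (H _ iso) => -[[k x]|y]; last by left; split=> //; exact: Aa.
by right; exists (i k), (j k), x; split=> //; exists k.
Qed.

End Elementary.

(** * Global types and strong splitting *)

Section Small.
Variables (K : Type) (Knat : small K [set: nat]).

Lemma small_le (T U : Type) (A : set T) (B : set U) :
  A #<= B -> small K B -> small K A.
Proof.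
move=> AB /andP[BK nKB]; apply/andP; split; first exact: card_le_trans BK.
by apply: contra nKB => KA; exact: card_le_trans AB.
Qed.

Lemma small_countable (T : Type) (A : set T) : countable A -> small K A.
Proof. by move=> cA; exact: small_le Knat. Qed.

Lemma small_setU (T : Type) (A B : set T) :
  small K A -> small K B -> small K (A `|` B).
Proof.
wlog AB : A B / A #<= B => [H sA sB|sA sB].
  by have [|] := card_le_total A B => ?; [|rewrite setUC]; exact: H.
have [Bfin|Binf] := pselect (finite_set B).
  apply: small_countable; apply: finite_set_countable.
  by rewrite finite_setU; split=> //; exact: card_le_finite AB Bfin.
exact: small_le (card_le_setU Binf AB) sB.
Qed.

Lemma small_family (C : semantics) (T : countType) (X : ctx (esort C))
    (a : T -> env (@elt C) X) (D : set T) :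
  small K [set u | exists t x, D t /\ u = coord (a t) x].
Proof.
apply: small_countable.
apply: (@sub_countable _ _ _ [set: T * X]); last exact: countableP.
apply: card_le_trans (card_image_le (fun z => coord (a z.1) z.2) _).
by apply: subset_card_le => u [t [x [_ ->]]]; exists (t, x).
Qed.

End Small.

(* [finI_filter] does not apply to families of conditions: they quantify over
   contexts, hence live in too large a universe for [set] and [{fset _}]. *)
Lemma finite_intersections_filter (T I : Type) (D : I -> Prop) (f : I -> set T) :
  (forall n (i : 'I_n -> I), (forall k, D (i k)) -> exists t, forall k, f (i k) t) ->
  exists2 F : set_system T, ProperFilter F & forall i, D i -> F (f i).
Proof.
move=> fip.
exists (fun S => exists n (i : 'I_n -> I), (forall k, D (i k)) /\
    forall t, (forall k, f (i k) t) -> S t); last first.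
  by move=> i Di; exists 1%N, (fun=> i); split=> // t /(_ ord0).
split=> [[n [i [/fip[t tP] /(_ _ tP)]]]//|].
split=> [|S S' [n [i [Di iS]]] [n' [i' [Di' iS']]]|S S' SS' [n [i [Di iS]]]].
- exists 0%N; suff [i] : $|'I_0 -> I| by exists i; split=> // -[].
  by squash (fun k : 'I_0 => match notF (ltn_ord k) with end).
- exists (n + n')%N,
    (fun k => match fintype.split k with inl a => i a | inr b => i' b end).
  split=> [k|t tP]; first by case: (fintype.split k).
  split; [apply: iS => k; have := tP (unsplit (inl k))|
          apply: iS' => k; have := tP (unsplit (inr k))]; by rewrite unsplitK.
- by exists n, i; split=> // t /iS/SS'.
Qed.

Lemma cvg_pair_comp (T : Type) (F : set_system T) {FF : Filter F}
    (U V W : topologicalType)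
    (f : T -> U) (g : T -> V) (h : U * V -> W) (u : U) (v : V) :
  continuous h -> f @ F --> u -> g @ F --> v ->
  (fun t => h (f t, g t)) @ F --> h (u, v).
Proof.
move=> hc fu gv.
apply: (cvg_comp (fun t => (f t, g t)) h _ (hc (u, v))).
exact: cvg_pair fu gv.
Qed.

Lemma tail_filter_proper (d : Order.disp_t) (O : orderType d) :
  endless O -> ProperFilter (@tail_filter d O).
Proof.
move=> [[i0 _] _]; apply: filter_from_proper => [|i _]; last by exists i => /=.
apply: filter_from_filter; first by exists i0.
move=> i j _ _; exists (Order.max i j) => // k /=.
by rewrite ge_max => /andP.
Qed.

Lemma indiscernible_sub (C : semantics) (A B : set (element (@elt C)))
    (d : Order.disp_t) (O : orderType d) (X : ctx (esort C))
    (J : O -> env (@elt C) X) :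
  A `<=` B -> indiscernible B J -> indiscernible A J.
Proof. by move=> AB HB n Y phi a i j aA; apply: HB => y; exact/AB. Qed.

(** * Global types as limits along filters *)

Section GlobalTypes.
Variables (K : Type) (C : semantics) (tameC : tame K C).
Local Notation tuple X := (env (@elt C) X).
Local Notation pt := (element (@elt C)).

Lemma limit_complete_type (T : Type) (F : set_system T) (X : ctx (esort C))
    (a : T -> tuple X) (p : pretype X) (B : set pt) :
  ProperFilter F ->
  (forall Y (phi : fml (ctx_cat X Y)) (b : tuple Y), env_in B b ->
    (fun t => eval phi (env_cat (a t) b)) @ F --> p Y phi b) ->
  complete_type B p.
Proof.
move=> FF Fp n Y phi b U bB pU.
suff /filter_ex[t tU] : F [set t | forall k, U k (eval (phi k) (env_cat (a t) (b k)))].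
  by exists (a t).
by apply: filter_forall => k; exact: (Fp _ _ _ (bB k) _ (pU k)).
Qed.

Definition condition (X : ctx (esort C)) : Type :=
  {Y : ctx (esort C) & (fml (ctx_cat X Y) * tuple Y * set (value C))%type}.

Definition solutions (X : ctx (esort C)) (c : condition X) : set (tuple X) :=
  [set a | (projT2 c).2 (eval (projT2 c).1.1 (env_cat a (projT2 c).1.2))].

(** A global type need not be realised, but its conditions have the finite intersection property and
    so generate a filter along which realised types converge to it. *)
Lemma global_type_filter (X : ctx (esort C)) (p : pretype X) :
  global_type p -> exists2 F : set_system (tuple X), ProperFilter F &
    forall Y (phi : fml (ctx_cat X Y)) (b : tuple Y),
      (fun a => eval phi (env_cat a b)) @ F --> p Y phi b.
Proof.
move=> gp.
pose D (c : condition X) : Prop :=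
  nbhs (p _ (projT2 c).1.1 (projT2 c).1.2) (projT2 c).2.
have [n c Dc|F FF FD] := @finite_intersections_filter _ _ D (@solutions X).
  have [//|//|a aP] := @gp _ (fun k => projT1 (c k))
    (fun k => (projT2 (c k)).1.1) (fun k => (projT2 (c k)).1.2)
    (fun k => (projT2 (c k)).2); last by exists a.
exists F => // Y phi b U pU.
exact: (FD (existT _ Y (phi, b, U)) pU).
Qed.

(** Continuous connectives commute with limits, and limits in a Hausdorff space are unique. *)
Lemma global_type_separate (X : ctx (esort C)) (p : pretype X)
    (Y Z W : ctx (esort C)) (phi : fml (ctx_cat X Y)) (b : tuple Y)
    (phi' : fml (ctx_cat X Z)) (b' : tuple Z)
    (psi : fml (ctx_cat X W)) (c : tuple W)
    (h : value C * value C -> value C) :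
  global_type p -> continuous h ->
  (forall a, eval psi (env_cat a c) =
    h (eval phi (env_cat a b), eval phi' (env_cat a b'))) ->
  p W psi c = h (p Y phi b, p Z phi' b').
Proof.
move=> /global_type_filter[F FF Fp] hc psiE.
have Fh : (fun a => eval psi (env_cat a c)) @ F --> h (p Y phi b, p Z phi' b').
  rewrite (funext psiE).
  exact: (cvg_pair_comp hc (Fp Y phi b) (Fp Z phi' b')).
exact: (@cvg_unique _ (tame_hausdorff tameC)
  ((fun a => eval psi (env_cat a c)) @ F) _ _ _ (Fp W psi c) Fh).
Qed.

(** For global types this is nonforking over [A]: a true dividing formula is a disjunction of length
    one, and conversely [p] is a completion of itself in which some disjunct would be true. *)
Definition avoids_dividing (A : set pt) (X : ctx (esort C)) (p : pretype X) :=
  forall Y (phi : fml (ctx_cat X Y)) (b : tuple Y),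
    divides A phi b -> p Y phi b <> true_value C.

Lemma nonforking_avoids_dividing (A : set pt) (X : ctx (esort C))
    (p : pretype X) :
  ~ forks A setT p -> avoids_dividing A p.
Proof.
move=> nf Y phi b div pT; apply: nf.
exists 1%N, (fun _ => Y), (fun _ => phi), (fun _ => b); split=> // q _ qp.
by exists ord0; rewrite qp.
Qed.

Lemma avoids_dividing_nonforking (A : set pt) (X : ctx (esort C))
    (p : pretype X) :
  global_type p -> avoids_dividing A p -> ~ forks A setT p.
Proof.
move=> gp ap [n [Y [phi [b [div H]]]]].
by have [//|k] := H p gp; exact: ap.
Qed.

Section Dependent.
Hypothesis depC : dependent K C.
Variable A : set pt.

Lemma strong_splitting (X Y : ctx (esort C)) (p : pretype X)
    (J : nat -> tuple Y) (phi : fml (ctx_cat X Y)) :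
  global_type p -> avoids_dividing A p -> indiscernible A J ->
  p Y phi (J 0%N) = p Y phi (J 1%N).
Proof.
move=> gp ap Jind; apply: contrapT => vw.
(* [h] is true at the two distinct values and never on the diagonal. *)
have [h [hc hvw hll hex]] := tame_separate tameC vw.
pose Z := ctx_cat X (ctx_cat Y Y).
pose m1 (z : ctx_cat X Y) : Z := match z with inl x => inl x | inr y => inr (inl y) end.
pose m2 (z : ctx_cat X Y) : Z := match z with inl x => inl x | inr y => inr (inr y) end.
have [|phi1 phi1P] := tame_rename tameC phi (m := m1); first by case.
have [|phi2 phi2P] := tame_rename tameC phi (m := m2); first by case.
have [psi psiP] := hex _ phi1 phi2.
have psiE a b b' : eval psi (env_cat a (env_cat b b')) =
    h (eval phi (env_cat a b), eval phi (env_cat a b')).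
  rewrite psiP; congr (h (_, _)); first by apply: phi1P; case.
  by apply: phi2P; case.
(* Consecutive terms are paired; an order isomorphism [o] on pairs lifts to [o2], which acts on even
   and odd positions alike. *)
pose J2 n := env_cat (J n.*2) (J n.*2.+1).
apply: (ap _ psi (J2 0%N)).
  exists J2; split=> //.
    apply: shift_indiscernible => o oiso.
    pose o2 k l := exists i i' e, [/\ o i i', (e < 2)%N, k = i.*2 + e & l = i'.*2 + e]%N.
    have o2iso : order_iso o2.
      move=> k l k' l' [i [i' [e [oi e2 -> ->]]]] [j [j' [f [oj f2 -> ->]]]].
      have := oiso _ _ _ _ oi oj; have := oiso _ _ _ _ oj oi.
      rewrite !ltEnat /=.
      have dblE m n : (m.*2 + e < n.*2 + f)%N = (m < n)%N || ~~ (n < m)%N && (e < f)%N.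
        by lia.
      by rewrite !dblE => -> ->.
    move=> X' chi a a' aa'; apply: (indiscernible_shift tameC Jind o2iso) => x.
    have [[? ?]|[i [i' [[y|y] [oi E E']]]]] := aa' x; first by left.
      right; exists i.*2, i'.*2, y; split=> //.
      by exists i, i', 0%N; rewrite !addn0.
    right; exists i.*2.+1, i'.*2.+1, y; split=> //.
    by exists i, i', 1%N; rewrite !addn1.
  move=> [a aP].
  (* Dependence speaks of limits in the first variables, so the roles of [x] and [y] are
     exchanged. *)
  pose ms (z : ctx_cat X Y) : ctx_cat Y X :=
    match z with inl x => inr x | inr y => inl y end.
  have [|phis phisP] := tame_rename tameC phi (m := ms); first by case.
  have phisE b : eval phis (env_cat b a) = eval phi (env_cat a b).
    by apply: phisP; case.
  have natE : endless nat.
    split=> [|i]; first by exists 0%N.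
    by exists i.+1; rewrite ltEnat /=.
  have Jind0 : indiscernible set0 J.
    by apply: indiscernible_sub Jind => ?.
  have : cvg ((fun k => eval phis (env_cat (J k) a)) @ @tail_filter _ nat).
    have natW : well_founded (fun i j : nat => (i < j)%O).
      by apply: (Wf_nat.well_founded_lt_compat _ id) => i j; rewrite ltEnat => /ssrnat.ltP.
    apply: (@depC _ nat Y X J phis a natE natW _ Jind0).
    exact: (small_family (tame_small_nat tameC) J setT).
  rewrite (funext (fun k => phisE (J k))) => /cvg_ex[l ul].
  have tailP := tail_filter_proper natE.
  pose u k := eval phi (env_cat a (J k)).
  have ul0 : (fun k => u k.*2) @ @tail_filter _ nat --> l.
    move=> U /ul[i _ iU]; exists i => // k /= ik; apply: iU => /=.
    by rewrite leEnat in ik *; rewrite -addnn; exact: leq_trans ik (leq_addr _ _).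
  have ul1 : (fun k => u k.*2.+1) @ @tail_filter _ nat --> l.
    move=> U /ul[i _ iU]; exists i => // k /= ik; apply: iU => /=.
    by rewrite leEnat in ik *; rewrite -addnn -addnS; exact: leq_trans ik (leq_addr _ _).
  apply: (hll l).
  (* The even and the odd subsequence share the limit [l], so a constantly true value would tend to
     [h (l, l)]. *)
  have hl : (fun k => h (u k.*2, u k.*2.+1)) @ @tail_filter _ nat --> h (l, l).
    exact: (cvg_pair_comp hc ul0 ul1).
  have hT : (fun k => h (u k.*2, u k.*2.+1)) @ @tail_filter _ nat --> true_value C.
    rewrite (_ : (fun k => _) = fun=> true_value C); first exact: cvg_cst.
    by apply/funext => k; rewrite -psiE; exact: aP.
  exact: (@cvg_unique _ (tame_hausdorff tameC) _ _ _ _ hl hT).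
(* It remains that [p] makes the dividing formula true at the first pair. *)
rewrite (global_type_separate (h := h) (phi := phi) (b := J 0%N)
  (phi' := phi) (b' := J 1%N) gp hc) //.
by move=> a; rewrite psiE.
Qed.

End Dependent.
End GlobalTypes.

(** * Invariance along the sequence *)

Section Endless.
Variables (d : Order.disp_t) (O : orderType d) (endlessO : endless O).

Lemma endless_bound (s : seq O) : exists m : O, forall i, i \in s -> (i < m)%O.
Proof.
have [[i0 _] next] := endlessO.
elim: s => [|i s [m ms]]; first by exists i0.
have [m' mm'] := next (Order.max i m); exists m' => k.
move: mm'; rewrite gt_max inE => /andP[im' mm'] /orP[/eqP->//|/ms km].
exact: lt_trans km mm'.
Qed.

Lemma endless_chain (m : O) : exists ch : nat -> O,
  (forall k, (m < ch k)%O) /\ (forall k l, (k < l)%N -> (ch k < ch l)%O).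
Proof.
have [_ /choice[next nextP]] := endlessO.
pose ch k := iter k.+1 next m.
have ch_lt k l : (k < l)%N -> (ch k < ch l)%O.
  by apply: (homo_ltn (r := <%O)) => [y x z|i]; [exact: lt_trans|exact: nextP].
exists ch; split=> // -[|k]; first exact: nextP.
by apply: lt_trans (ch_lt 0%N k.+1 _); [exact: nextP|].
Qed.

End Endless.

Lemma chain_ltE (d : Order.disp_t) (O : orderType d) (ch : nat -> O) :
  (forall k l, (k < l)%N -> (ch k < ch l)%O) ->
  forall k l, (ch k < ch l)%O = (k < l)%N.
Proof.
move=> ch_lt k l; have [kl|lk|->] := ltngtP k l; first exact: ch_lt.
  by apply/negbTE; rewrite -leNgt ltW ?ch_lt.
by rewrite ltxx.
Qed.

Section Invariance.
Variables (K : Type) (C : semantics) (tameC : tame K C).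
Hypothesis depC : dependent K C.
Local Notation tuple X := (env (@elt C) X).
Local Notation pt := (element (@elt C)).
Variables (A : set pt) (d : Order.disp_t) (O : orderType d).
Variables (X : ctx (esort C)) (J : O -> tuple X).
Hypotheses (endlessO : endless O) (Jind : indiscernible A J).

Section Rank.
Variables (Y : ctx (esort C)) (t : Y -> option (O * X)).

(** [t] locates coordinates: [None] stands for an element of [A], [Some (i, x)] for the coordinate
    [x] of the term with index [i]. The size of [below i] is a rank of [i] that depends on the order
    pattern alone. *)
Definition below (i : O) : pred Y :=
  [pred y | if t y is Some (k, _) then (k < i)%O else false].

Lemma rank_lt y y' i i' x x' : t y = Some (i, x) -> t y' = Some (i', x') ->
  (#|below i| < #|below i'|)%N = (i < i')%O.
Proof.
move=> ty ty'; have [ii'|i'i] := ltP i i'.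
  apply: proper_card; apply/properP; split.
    apply/fintype.subsetP => z; rewrite !inE; case: (t z) => // -[k _] ki.
    exact: lt_trans ki ii'.
  by exists y; rewrite !inE ty // ltxx.
apply/negbTE; rewrite -leqNgt; apply: subset_leq_card.
apply/fintype.subsetP => z; rewrite !inE; case: (t z) => // -[k _] ki.
exact: lt_le_trans ki i'i.
Qed.

(* The copies J_1, J_2, ... of b = J_0 lie in consecutive blocks of the chain. *)
Lemma chain_invariant (Z : ctx (esort C)) (p : pretype Z)
    (phi : fml (ctx_cat Z Y)) (b b' : tuple Y) (ch : nat -> O) :
  global_type p -> avoids_dividing A p ->
  (forall y, match t y with
    | None => A (coord b y) | Some (i, x) => coord b y = coord (J i) x end) ->
  (forall k l, (k < l)%N -> (ch k < ch l)%O) ->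
  (forall y i x, t y = Some (i, x) -> (i < ch 0%N)%O) ->
  (forall y, coord b' y = match t y with
    | None => coord b y | Some (i, x) => coord (J (ch #|below i|)) x end) ->
  p Y phi b = p Y phi b'.
Proof.
move=> gp ap bt ch_lt t_ch b't.
(* Ranks range from 0 to [#|Y|], hence blocks of length [#|Y|.+1]. Copy 0 keeps the original
   indices, all below the chain. *)
pose idx r i := if r is r'.+1 then ch (r' * #|Y|.+1 + #|below i|)%N else i.
pose tgt r y := match t y with
  | None => coord b y | Some (i, x) => coord (J (idx r i)) x end.
have exJ (z : nat * Y) : exists e : elt (csort z.2), existT _ _ e = tgt z.1 z.2.
  case: z => r y; rewrite /tgt /=; have := bt y; case: (t y) => [[i x]|_]; last first.
    by exists (b y).
  by move=> by_; apply: coord_transport; rewrite (existT_inj1 by_).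
pose JJ r : tuple Y := fun y => projT1 (cid (exJ (r, y))).
have JJE r y : coord (JJ r) y = tgt r y.
  exact: (projT2 (cid (exJ (r, y)))).
have -> : b = JJ 0%N.
  apply: coord_inj => y; rewrite JJE /tgt.
  by have := bt y; case: (t y) => // -[].
have -> : b' = JJ 1%N.
  by apply: coord_inj => y; rewrite JJE /tgt b't.
apply: (strong_splitting tameC depC _ gp ap).
have ch0 i k : (i < ch 0%N)%O -> (i < ch k)%O.
  by move=> ich; apply: lt_le_trans ich _; rewrite leNgt chain_ltE.
(* Positions are ordered lexicographically, by copy and then by original index; hence an isomorphism
   [o] of copies induces the isomorphism [o'] of positions below. *)
have idx_lt y y' i i' x x' r r' : t y = Some (i, x) -> t y' = Some (i', x') ->
    (idx r i < idx r' i')%O = (r < r')%N || (r == r') && (i < i')%O.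
  move=> ty ty'; have i_ch := t_ch _ _ _ ty; have i'_ch := t_ch _ _ _ ty'.
  case: r r' => [|r] [|r'] //=.
  - exact: ch0.
  - by apply/negbTE; rewrite -leNgt ltW // ch0.
  rewrite chain_ltE // eqSS ltnS -(rank_lt ty ty').
  move: (max_card (below i)) (max_card (below i')).
  move: #|below i| #|below i'| #|Y| => k k' n kn k'n.
  case: (ltngtP r r') => [rr'|rr'|->]; last by rewrite ltn_add2l.
    have : (r.+1 * n.+1 <= r' * n.+1)%N by rewrite leq_mul2r rr' orbT.
    by rewrite mulSn; lia.
  have : (r'.+1 * n.+1 <= r * n.+1)%N by rewrite leq_mul2r rr' orbT.
  by rewrite mulSn; lia.
apply: shift_indiscernible => o oiso.
pose o' u v := exists r r' y i x,
  [/\ o r r', t y = Some (i, x), u = idx r i & v = idx r' i].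
have o'iso : order_iso o'.
  move=> u v u' v' [r [r' [y [i [x [orr' ty -> ->]]]]]].
  move=> [s [s' [y' [i' [x' [oss' ty' -> ->]]]]]].
  rewrite (idx_lt _ _ _ _ _ _ _ _ ty ty') (idx_lt _ _ _ _ _ _ _ _ ty ty').
  have := oiso _ _ _ _ orr' oss'; have := oiso _ _ _ _ oss' orr'.
  rewrite !ltEnat /= !eqn_leq (leqNgt r) (leqNgt s) (leqNgt r') (leqNgt s').
  by move=> -> ->.
move=> W chi a a' aa'; apply: (indiscernible_shift tameC Jind o'iso) => w.
have [?|[r [r' [y [orr' -> ->]]]]] := aa' w; first by left.
rewrite !JJE /tgt; have := bt y; case ty : (t y) => [[i x]|] by_.
  by right; exists (idx r i), (idx r' i), x; split=> //; exists r, r', y, i, x.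
by left.
Qed.

End Rank.

(** Ranks are preserved by [o], so both tuples move to the same tuple [c] in a chain beyond all
    indices involved, and both moves preserve the value under [p]. *)
Lemma order_invariant (Y Z : ctx (esort C)) (p : pretype Z)
    (phi : fml (ctx_cat Z Y)) (b b' : tuple Y) (o : O -> O -> Prop) :
  global_type p -> avoids_dividing A p -> order_iso o ->
  (forall y, shift A J o (coord b y) (coord b' y)) ->
  p Y phi b = p Y phi b'.
Proof.
move=> gp ap oiso bb'.
pose Q y (t : option (O * O * X)) : Prop :=
  match t with
  | None => A (coord b y) /\ coord b y = coord b' y
  | Some (i, i', x) =>
      [/\ o i i', coord b y = coord (J i) x & coord b' y = coord (J i') x] end.
have /choice[t tP] y : exists t, Q y t.
  have [[? ?]|[i [i' [x ?]]]] := bb' y; first by exists None.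
  by exists (Some (i, i', x)).
pose t1 y := omap (fun z : O * O * X => (z.1.1, z.2)) (t y).
pose t2 y := omap (fun z : O * O * X => (z.1.2, z.2)) (t y).
have [m mP] := endless_bound endlessO
  (pmap (omap fst) (codom t1) ++ pmap (omap fst) (codom t2)).
have [ch [m_ch ch_lt]] := endless_chain endlessO m.
have t1_ch y i x : t1 y = Some (i, x) -> (i < ch 0%N)%O.
  move=> t1y; apply: lt_trans (m_ch _); apply: mP.
  rewrite mem_cat !mem_pmap; apply/orP; left; apply/mapP; exists (t1 y).
    exact: codom_f.
  by rewrite t1y.
have t2_ch y i x : t2 y = Some (i, x) -> (i < ch 0%N)%O.
  move=> t2y; apply: lt_trans (m_ch _); apply: mP.
  rewrite mem_cat !mem_pmap; apply/orP; right; apply/mapP; exists (t2 y).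
    exact: codom_f.
  by rewrite t2y.
have below12 y i i' x : t y = Some (i, i', x) -> #|below t1 i| = #|below t2 i'|.
  move=> ty; apply: eq_card => z; rewrite !inE /t1 /t2.
  have := tP y; rewrite ty => -[oii' _ _].
  have := tP z; case: (t z) => [[[k k'] w]|] //= [okk' _ _].
  exact: oiso.
have ex_c y : exists e : elt (csort y), existT _ _ e =
    match t1 y with None => coord b y | Some (i, x) => coord (J (ch #|below t1 i|)) x end.
  rewrite /t1; have := tP y; case: (t y) => [[[i i'] x]|] /=; last first.
    by move=> _; exists (b y).
  by move=> [_ E _]; apply: coord_transport; rewrite (existT_inj1 E).
pose c : tuple Y := fun y => projT1 (cid (ex_c y)).
have cE y : coord c y = match t1 y with
    None => coord b y | Some (i, x) => coord (J (ch #|below t1 i|)) x end.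
  exact: (projT2 (cid (ex_c y))).
transitivity (p Y phi c).
  apply: (chain_invariant phi gp ap _ ch_lt t1_ch cE) => y.
  by rewrite /t1; have := tP y; case: (t y) => [[[i i'] x]|] /= [].
symmetry; apply: (chain_invariant phi gp ap _ ch_lt t2_ch) => y.
  rewrite /t2; have := tP y; case: (t y) => [[[i i'] x]|] /= [] //.
  by move=> ? <-.
rewrite cE /t1 /t2; case ty : (t y) => [[[i i'] x]|] /=.
  by rewrite (below12 _ _ _ _ ty).
by have := tP y; rewrite ty => -[].
Qed.

(** Terms of [J] from [m] on have the same type over [A] and the terms below [m], so the limit is
    that of an eventually constant family. *)
Lemma Av_eval (Y : ctx (esort C)) (phi : fml (ctx_cat X Y)) (b : tuple Y) (m : O) :
  (forall y, A (coord b y) \/ exists i x, (i < m)%O /\ coord b y = coord (J i) x) ->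
  forall k, (m <= k)%O -> Av J phi b = eval phi (env_cat (J k) b).
Proof.
move=> bm k mk; have JE i : (m <= i)%O ->
    eval phi (env_cat (J i) b) = eval phi (env_cat (J k) b).
  move=> mi; pose o u v := (u = v /\ (u < m)%O) \/ (u = i /\ v = k).
  have oiso : order_iso o.
    move=> u v u' v' [[<- um]|[-> ->]] [[<- u'm]|[-> ->]] //.
    - by rewrite (lt_le_trans um mi) (lt_le_trans um mk).
    - by rewrite !ltNge !(le_trans (ltW u'm)).
    - by rewrite !ltxx.
  apply: (indiscernible_shift tameC Jind oiso) => -[x|y].
    by right; exists i, k, x; split=> //; right.
  have [Ay|[l [x [lm E]]]] := bm y; first by left.
  by right; exists l, l, x; split=> //; left.
have tailP := tail_filter_proper endlessO.
apply: cvg_lim; first exact: tame_hausdorff tameC.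
apply: cvg_near_cst; exists m => // i /= mi; exact: JE.
Qed.

End Invariance.

(** * Uniqueness *)

Section Transport.
Variable C : semantics.
Local Notation tuple X := (env (@elt C) X).
Local Notation pt := (element (@elt C)).
Variables (g g' : forall s, @elt C s -> @elt C s).
Hypotheses (gK : forall s, cancel (@g s) (@g' s)) (g'K : forall s, cancel (@g' s) (@g s)).
Hypothesis g_elem : elementary_on setT g.

Definition env_map (f : forall s, @elt C s -> @elt C s) (X : ctx (esort C))
  (a : tuple X) : tuple X := fun x => f _ (a x).

Lemma eval_map (X : ctx (esort C)) (phi : fml X) (a : tuple X) :
  eval phi (env_map g a) = eval phi a.
Proof. by apply: g_elem => x. Qed.

Lemma env_map_cat f (X Y : ctx (esort C)) (a : tuple X) (b : tuple Y) :
  env_map f (env_cat a b) = env_cat (env_map f a) (env_map f b).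
Proof. by apply: functional_extensionality_dep; case. Qed.

Lemma env_mapK (X : ctx (esort C)) (a : tuple X) :
  env_map g (env_map g' a) = a.
Proof. by apply: functional_extensionality_dep => x; exact: g'K. Qed.

Lemma eval_map_cat (X Y : ctx (esort C)) (phi : fml (ctx_cat X Y))
    (a : tuple X) (b : tuple Y) :
  eval phi (env_cat (env_map g a) b) = eval phi (env_cat a (env_map g' b)).
Proof. by rewrite -[RHS]eval_map env_map_cat env_mapK. Qed.

(** The conjugate of [p] by [g], hence the inverse [g'] on the parameters. *)
Definition transport_type (X : ctx (esort C)) (p : pretype X) : pretype X :=
  fun Y phi b => p Y phi (env_map g' b).

Lemma transport_global (X : ctx (esort C)) (p : pretype X) :
  global_type p -> global_type (transport_type p).
Proof.
move=> gp n Y phi b U bT pU.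
have [k|a aU] := gp n Y phi (fun k => env_map g' (b k)) U _ pU; first by [].
by exists (env_map g a) => k; rewrite eval_map_cat.
Qed.

Variable A : set pt.
Hypothesis gA : forall s (e : @elt C s), A (existT _ s e) -> g e = e.

Lemma env_map_fixed (X : ctx (esort C)) (a : tuple X) :
  env_in A a -> env_map g' a = a.
Proof.
move=> aA; apply: functional_extensionality_dep => x.
by rewrite /env_map -{1}(gA (aA x)) gK.
Qed.

(** The preimage under [g] of a sequence witnessing division over [A] is again such a witness,
    because [g] fixes [A] pointwise. *)
Lemma transport_avoids_dividing (X : ctx (esort C)) (p : pretype X) :
  avoids_dividing A p -> avoids_dividing A (transport_type p).
Proof.
move=> ap Y phi b [J [Jind J0 nJ]]; apply: ap.
exists (fun k => env_map g' (J k)); split=> [n Z chi a i j aA ilt jlt||[a aJ]].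
- have E h : eval chi (env_cat (env_pow (fun k => env_map g' (J (h k)))) a) =
    eval chi (env_cat (env_pow (fun k => J (h k))) a).
    rewrite -[LHS]eval_map -[in LHS](env_map_fixed aA) env_map_cat env_mapK.
    congr (eval chi (env_cat _ _)); apply: functional_extensionality_dep => z.
    exact: g'K.
  by rewrite !E; exact: Jind.
- by rewrite J0.
- by apply: nJ; exists (env_map g a) => k; rewrite eval_map_cat.
Qed.

End Transport.

(** * Continuation of an indiscernible sequence by realisations of global types *)

Section Uniqueness.
Variables (K : Type) (C : semantics) (tameC : tame K C).
Hypothesis depC : dependent K C.
Local Notation tuple X := (env (@elt C) X).
Local Notation pt := (element (@elt C)).
Variables (A : set pt) (d : Order.disp_t) (O : orderType d).
Variables (X : ctx (esort C)) (J : O -> tuple X).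
Hypotheses (endlessO : endless O) (Jind : indiscernible A J).
Hypotheses (Asmall : small K A) (Jsmall : small K (entries J setT)).

(** Cutting [J] at [i0] leaves room above it for the images of the terms of [c]. *)
Definition tail_map (c : nat -> tuple X) (n : nat) (i0 : O) (j : nat -> O)
    (u v : pt) : Prop :=
  shift A J (fun i i' => i = i' /\ (i <= i0)%O) u v \/
  exists k x, [/\ (k < n)%N, u = coord (c k) x & v = coord (J (j k)) x].

(* J followed by c 0, ..., c (n - 1) is A-indiscernible. *)
Definition continues (c : nat -> tuple X) (n : nat) : Prop :=
  forall i0 j, (forall k, (i0 < j k)%O) ->
    (forall k l, (k < l)%N -> (j k < j l)%O) -> elementary_rel (tail_map c n i0 j).

Definition history (c : nat -> tuple X) (n : nat) : set pt :=
  A `|` entries J setT `|` [set u | exists k x, (k < n)%N /\ u = coord (c k) x].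

Lemma small_history c n : small K (history c n).
Proof.
have Knat := tame_small_nat tameC.
apply: (small_setU Knat); first exact: (small_setU Knat).
exact: (small_family Knat c [set k | (k < n)%N]).
Qed.

Lemma continues0 c : continues c 0.
Proof.
move=> i0 j _ _ Y phi a a' aa'.
have oiso : order_iso (fun i i' : O => i = i' /\ (i <= i0)%O).
  by move=> i i' k k' [-> _] [-> _].
by apply: (indiscernible_shift tameC Jind oiso) => y; have [//|[k [x []]]] := aa' y.
Qed.

Section Step.
Variables (p : pretype X) (gp : global_type p) (ap : avoids_dividing A p).
Hypothesis pAv : agree_on (A `|` entries J setT) p (Av J).
Variables (c : nat -> tuple X) (n : nat).
Hypotheses (c_cont : continues c n) (cp : agree_on (history c n) (tp (c n)) p).

(** The parameters [b] mix terms of [c] and [J]. An automorphism [g] over [A] moves them into [J],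
    and the conjugate of [p] is again a global type avoiding division over [A], to which invariance
    along [J] applies. *)
Lemma tail_map_invariant (i0 : O) (j : nat -> O) (Y : ctx (esort C))
    (phi : fml (ctx_cat X Y)) (b b' : tuple Y) :
  (forall k, (i0 < j k)%O) -> (forall k l, (k < l)%N -> (j k < j l)%O) ->
  (forall y, tail_map c n i0 j (coord b y) (coord b' y)) ->
  @p Y phi b = @p Y phi b'.
Proof.
move=> i0j j_lt bb'.
(* All targets [j k] with [k < n] lie below [i1], where [g] will fix the terms of [J]; the terms of
   [c] are sent beyond [i1]. *)
pose i1 := j n; pose j' k := j (n.+1 + k)%N.
have i1j' k : (i1 < j' k)%O by apply: j_lt; rewrite addSn ltnS leq_addr.
have j'_lt k l : (k < l)%N -> (j' k < j' l)%O by move=> kl; apply: j_lt; rewrite ltn_add2l.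
pose r := tail_map c n i1 j'.
have r_elem : elementary_rel r by exact: c_cont.
pose B : set pt := [set u | exists v, r u v].
(* Off the domain of [r] the value [e] is an arbitrary default: only the restriction of [f] to [B]
   has to be elementary. *)
pose f s (e : @elt C s) : elt s :=
  match pselect (exists v, r (existT _ s e) (existT _ s v)) with
  | left h => projT1 (cid h) | right _ => e end.
have fP s (e v : elt s) : r (existT _ s e) (existT _ s v) -> f s e = v.
  move=> ev; rewrite /f; case: pselect => [h|nh]; last by case: nh; exists v.
  exact: (elementary_rel_fun tameC r_elem (projT2 (cid h)) ev).
have rsort u v : r u v -> projT1 u = projT1 v.
  by move=> [[[_ ->//]|[i [i' [x [_ -> ->]]]]]|[k [x [_ -> ->]]]].
have fr s (e : elt s) : B (existT _ s e) -> r (existT _ s e) (existT _ s (f s e)).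
  move=> [[s' v] /[dup] /rsort /= E]; move: v; rewrite -E => v ev.
  by rewrite (fP _ _ _ ev).
have f_elem : elementary_on B f.
  by move=> Z chi a aB; symmetry; apply: r_elem => x; exact: fr (aB x).
have Bsmall : small K B.
  apply: small_le (small_history c n); apply: subset_card_le => u [v].
  move=> [[[Au _]|[i [i' [x [_ -> _]]]]]|[k [x [kn -> _]]]].
  - by left; left.
  - by left; right; exists i, x.
  - by right; exists k, x.
have [g [g' [gK g'K g_elem gf]]] := tame_homogeneous tameC Bsmall f_elem.
have gr s (e v : elt s) : r (existT _ s e) (existT _ s v) -> g s e = v.
  by move=> ev; rewrite gf; [exact: fP|exists (existT _ s v)].
have gA s (e : elt s) : A (existT _ s e) -> g s e = e.
  by move=> Ae; apply: gr; left; left.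
have gI i x : (i <= i1)%O -> g _ (J i x) = J i x.
  by move=> ii1; apply: gr; left; right; exists i, i, x.
have gc k x : (k < n)%N -> g _ (c k x) = J (j' k) x.
  by move=> kn; apply: gr; right; exists k, x.
have gcoord Z (a : tuple Z) z (a' : tuple X) x : coord a z = coord a' x ->
    coord (env_map g a) z = coord (env_map g a') x.
  pose G (u : pt) : pt := existT _ (projT1 u) (g _ (projT2 u)).
  by move=> /(f_equal G).
(* After [g], the tuples [b] and [b'] differ only by moving [j' k] back to [j k]. *)
pose o u v := (u = v /\ (u <= i0)%O) \/ exists k, [/\ (k < n)%N, u = j' k & v = j k].
have oiso : order_iso o.
  move=> u v u' v' [[<- ui]|[k [kn -> ->]]] [[<- u'i]|[l [ln -> ->]]] //.
  - by rewrite (le_lt_trans ui (i0j _)) (le_lt_trans ui (i0j _)).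
  - by rewrite !ltNge !(le_trans u'i (ltW (i0j _))).
  - by rewrite !(chain_ltE j_lt) ltn_add2l.
have i01 : (i0 <= i1)%O by apply: ltW; exact: i0j.
have E a : @p Y phi a = transport_type g' p phi (env_map g a).
  by rewrite /transport_type (env_mapK gK).
rewrite (E b) (E b').
apply: (order_invariant tameC depC endlessO Jind _ _ _ oiso).
- exact: transport_global gp.
- exact: transport_avoids_dividing ap.
move=> y; have [[[Ay E1]|[i [i' [x [[<- ii0] E1 E2]]]]]|[k [x [kn E1 E2]]]] := bb' y.
- left; split.
    by rewrite /coord /env_map gA.
  have Ay' : A (coord b' y) by rewrite -E1.
  by rewrite /coord /env_map !gA.
- right; exists i, i, x; rewrite (gcoord _ _ _ _ _ E1) (gcoord _ _ _ _ _ E2).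
  rewrite /coord /env_map gI ?(le_trans ii0 i01)//; split=> //; by left.
- right; exists (j' k), (j k), x; rewrite (gcoord _ _ _ _ _ E1) (gcoord _ _ _ _ _ E2).
  rewrite /coord /env_map gc // gI; last by apply/ltW/j_lt.
  by split=> //; right; exists k.
Qed.

(** Moving [b] to [b'] preserves the value under [p]. At [b'] this is the average value, which the
    term [J (j n)] already attains because [b'] lies in [A] and earlier terms. *)
Lemma continues_step : continues c n.+1.
Proof.
move=> i0 j i0j j_lt Z psi a a' aa'.
apply: (elementary_relU tameC (c := c n) (c' := J (j n))
  (r := tail_map c n i0 j)); last first.
  move=> z; have [?|[k [x [+ -> ->]]]] := aa' z; first by left; left.
  rewrite ltnS leq_eqVlt => /orP[/eqP->|kn]; first by right; exists x.
  by left; right; exists k, x.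
move=> Y phi b b' bb'.
have bH : env_in (history c n) b.
  move=> y; have [[[Ay _]|[i [i' [x [_ E _]]]]]|[k [x [kn E _]]]] := bb' y.
  - by left; left.
  - by left; right; exists i, x.
  - by right; exists k, x.
have b'H y : A (coord b' y) \/
    exists i x, (i < j n)%O /\ coord b' y = coord (J i) x.
  have [[[Ay E]|[i [i' [x [[<- ii0] _ E]]]]]|[k [x [kn _ E]]]] := bb' y.
  - by left; rewrite -E.
  - by right; exists i, x; split=> //; exact: le_lt_trans ii0 (i0j n).
  - by right; exists (j k), x; split=> //; exact: j_lt.
have b'AJ : env_in (A `|` entries J setT) b'.
  move=> y; have [Ay|[i [x [_ E]]]] := b'H y; first by left.
  by right; exists i, x.
rewrite -[LHS]/(tp (c n) phi b) cp // (tail_map_invariant phi i0j j_lt bb').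
by rewrite pAv // (Av_eval tameC endlessO Jind phi b'H (lexx _)).
Qed.

End Step.

(** Any finite part of [c] can be moved onto terms of [J], whose indiscernibility it inherits. *)
Lemma continues_indiscernible c :
  (forall n, continues c n) -> indiscernible A c.
Proof.
move=> c_cont n Y phi a i j aA ilt jlt.
have [[i0 _] _] := endlessO; have [ch [i0ch ch_lt]] := endless_chain endlessO i0.
have E (h : 'I_n -> nat) : eval phi (env_cat (env_pow (fun k => c (h k))) a) =
    eval phi (env_cat (env_pow (fun k => J (ch (h k)))) a).
  pose N := (\max_k h k).+1.
  apply: (c_cont N i0 ch i0ch ch_lt) => -[[k x]|y]; last first.
    by left; left; split=> //; exact: aA.
  by right; exists (h k), x; split=> //; rewrite ltnS; exact: leq_bigmax.
rewrite !E; apply: Jind => // k l kl; apply: ch_lt; [exact: ilt|exact: jlt].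
Qed.

(** Recursive choice in which each term may depend on all earlier ones; the list [L n] collects the
    first [n] choices. *)
Lemma history_choice (T : Type) (P : seq T -> T -> Prop) :
  (forall s, exists x, P s x) -> exists c : nat -> T, forall n, P (mkseq c n) (c n).
Proof.
move=> /choice[f fP].
pose L := fix L n := if n is n'.+1 then rcons (L n') (f (L n')) else [::].
exists (fun n => f (L n)) => n.
suff -> : mkseq (fun n => f (L n)) n = L n by exact: fP.
by elim: n => //= n IH; rewrite mkseqS IH.
Qed.

Lemma nonforking_extension_unique (p q : pretype X) :
  global_type p -> global_type q ->
  agree_on (A `|` entries J setT) p (Av J) ->
  agree_on (A `|` entries J setT) q (Av J) ->
  avoids_dividing A p -> avoids_dividing A q -> p = q.
Proof.
move=> gp gq pAv qAv ap aq.
apply: functional_extensionality_dep => Y.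
apply: functional_extensionality_dep => phi.
apply: functional_extensionality_dep => b.
apply: contrapT => pq.
have Knat := tame_small_nat tameC.
have [[i0 _] _] := endlessO.
pose r n := if odd n then q else p.
have r_global n : global_type (r n) by rewrite /r; case: odd.
(* The default [J i0] of [nth] is never read, as [history] only looks at positions below
   [size s]. *)
pose B s : set pt := history (nth (J i0) s) (size s) `|`
  [set u | exists t y, [set: unit] t /\ u = coord b y].
have Bsmall s : small K (B s).
  apply: (small_setU Knat); first exact: small_history.
  exact: (small_family Knat (fun _ : unit => b) setT).
have [s|c cP] := @history_choice _ (fun s x => agree_on (B s) (tp x) (r (size s))).
  apply: tame_saturated tameC _ _ _ (Bsmall s) _ => m Z psi e U eB rU.
  by apply: (r_global (size s)) rU => k y.
have c_hist n : agree_on (history c n) (tp (c n)) (r n).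
  move=> Z psi e eH; have := cP n Z psi e; rewrite size_mkseq; apply=> y.
  left; have [[?|?]|[k [x [kn E]]]] := eH y; [by left; left|by left; right|right].
  by exists k, x; rewrite size_mkseq nth_mkseq.
have c_cont n : continues c n.
  elim: n => [|n IH]; first exact: continues0.
  apply: (continues_step _ _ _ IH (c_hist n)) => //; by rewrite /r; case: odd.
have c_b n : eval phi (env_cat (c n) b) = r n Y phi b.
  have := cP n Y phi b; rewrite size_mkseq; apply=> y.
  by right; exists tt, y.
have natE : endless nat.
  split=> [|i]; first by exists 0%N.
  by exists i.+1; rewrite ltEnat /=.
have natW : well_founded (fun i j : nat => (i < j)%O).
  by apply: (Wf_nat.well_founded_lt_compat _ id) => i j; rewrite ltEnat => /ssrnat.ltP.
have cind : indiscernible set0 c.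
  by apply: indiscernible_sub (continues_indiscernible c_cont) => ?.
have csmall : small K (entries c setT) by exact: (small_family Knat c setT).
have := @depC _ nat X Y c phi b natE natW csmall cind.
rewrite (funext c_b) => /cvg_ex[l rl].
have tailP := tail_filter_proper natE.
(* On each parity class the values are constant, so the limit equals the value under both types. *)
have lim_r (e : bool) : l = (if e then q else p) Y phi b.
  have rle : (fun n => r (n.*2 + e)%N Y phi b) @ @tail_filter _ nat --> l.
    move=> U /rl[i _ iU]; exists i => // k /= ik; apply: iU => /=.
    by rewrite leEnat in ik *; rewrite -addnn -addnA; exact: leq_trans ik (leq_addr _ _).
  have cstE : (fun n => r (n.*2 + e)%N Y phi b) @ @tail_filter _ nat -->
      (if e then q else p) Y phi b.
    rewrite (_ : (fun n => _) = fun=> (if e then q else p) Y phi b).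
      exact: cvg_cst.
    by apply/funext => n; rewrite /r oddD odd_double oddb.
  exact: (@cvg_unique _ (tame_hausdorff tameC) _ _ _ _ rle cstE).
by apply: pq; rewrite -(lim_r true) -(lim_r false).
Qed.

End Uniqueness.

(** * Existence *)

Section Existence.
Variables (K : Type) (C : semantics) (tameC : tame K C).
Local Notation tuple X := (env (@elt C) X).
Local Notation pt := (element (@elt C)).
Variable A : set pt.

Lemma nbhs_not_true (v : value C) :
  v <> true_value C -> nbhs v [set w | w <> true_value C].
Proof.
move=> vT; apply: open_nbhs_nbhs; split=> //.
rewrite (_ : [set w | _] = ~` [set true_value C]) // openC.
by apply: accessible_closed_set1; apply: hausdorff_accessible; exact: tame_hausdorff tameC.
Qed.

(** A limit may turn values other than true into true, so avoidance needs a neighbourhood. If every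
    approximation of [phi] were consistent along [J], a realised ultralimit of the solutions would
    solve [phi] along all of [J]. *)
Lemma divides_approx (X Y : ctx (esort C)) (phi : fml (ctx_cat X Y)) (b : tuple Y) :
  divides A phi b ->
  exists psi : fml (ctx_cat X Y), divides A psi b /\
    exists2 N, nbhs (true_value C) N & forall a : tuple X,
      N (eval phi (env_cat a b)) -> eval psi (env_cat a b) = true_value C.
Proof.
move=> [J [Jind J0 nJ]].
have [psi [psi_near psi_lim]] := tame_approx tameC phi.
suff [n nJn] : exists n, ~ exists a : tuple X,
    forall i, eval (psi n) (env_cat a (J i)) = true_value C.
  exists (psi n); split; first by exists J.
  by have [N nN NP] := psi_near n; exists N => // a; exact: NP.
apply: contrapT => /forallNP nJn; apply: nJ.
have /choice[a aP] n : exists a : tuple X,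
    forall i, eval (psi n) (env_cat a (J i)) = true_value C.
  by apply: contrapT; exact: nJn.
have [F [FU Foo]] := ultraFilterLemma (F := \oo) _.
pose p : pretype X := fun Z chi e => lim ((fun n => eval chi (env_cat (a n) e)) @ F).
have Fp Z chi e : (fun n => eval chi (env_cat (a n) e)) @ F --> p Z chi e.
  exact: tame_ultra tameC _ _ FU _ _ (fun n => env_cat (a n) e).
have p_type : complete_type (entries J setT) p.
  exact: (limit_complete_type (F := F)).
have [a' a'P] := tame_saturated tameC
  (small_family (tame_small_nat tameC) J setT) p_type.
exists a' => i.
rewrite -[LHS]/(tp a' phi (J i)) a'P; last by move=> y; exists i, y.
have FT : (fun n => eval phi (env_cat (a n) (J i))) @ F --> true_value C.
  move=> U /psi_lim[n nU]; apply: Foo; exists n => // m /= nm.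
  exact: nU nm _ (aP m i).
exact: (@cvg_unique _ (tame_hausdorff tameC) _ _ _ _ (Fp Y phi (J i)) FT).
Qed.

Variables (d : Order.disp_t) (O : orderType d).
Variables (X : ctx (esort C)) (J : O -> tuple X).
Hypotheses (endlessO : endless O).

Lemma env_in_bounded (Y : ctx (esort C)) (b : tuple Y) :
  env_in (A `|` entries J setT) b -> exists m, forall y, A (coord b y) \/
    exists i x, (i < m)%O /\ coord b y = coord (J i) x.
Proof.
move=> bA; have [[i0 _] _] := endlessO.
have /choice[i iP] y : exists i, A (coord b y) \/ exists x, coord b y = coord (J i) x.
  have [Ay|[i [x [_ E]]]] := bA y; first by exists i0; left.
  by exists i; right; exists x.
have [m mP] := endless_bound endlessO (codom i).
exists m => y; have [Ay|[x E]] := iP y; [by left|right].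
by exists (i y), x; split=> //; apply: mP; exact: codom_f.
Qed.

Lemma nonforking_extension_exists : Morley_sequence A J ->
  exists p : pretype X, [/\ global_type p,
    agree_on (A `|` entries J setT) p (Av J) & avoids_dividing A p].
Proof.
move=> [Jind Jnf].
pose isAv (c : condition X) : Prop :=
  env_in (A `|` entries J setT) (projT2 c).1.2 /\
  nbhs (Av J (projT2 c).1.1 (projT2 c).1.2) (projT2 c).2.
(* An element failing such a condition satisfies a formula that divides over [A]. *)
pose isDiv (c : condition X) : Prop := exists psi, divides A psi (projT2 c).1.2 /\
  forall a : tuple X, ~ solutions c a ->
    eval psi (env_cat a (projT2 c).1.2) = true_value C.
have [n c Dc|F0 FF0 F0D] := @finite_intersections_filter _ _
    (fun c => isAv c \/ isDiv c) (@solutions C X).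
  have /choice[mk mkP] (k : 'I_n) : exists m : O, isAv (c k) -> forall y,
      A (coord (projT2 (c k)).1.2 y) \/
      exists i x, (i < m)%O /\ coord (projT2 (c k)).1.2 y = coord (J i) x.
    have [[/env_in_bounded[m mP] _]|nAv] := pselect (isAv (c k)); first by exists m.
    by have [[i0 _] _] := endlessO; exists i0.
  have [m mkm] := endless_bound endlessO (codom mk).
  have {}mkm k : (mk k < m)%O by apply: mkm; exact: codom_f.
  (* Were there no common solution, the type of [J m] over [A] and the earlier terms would imply the
     disjunction of the formulas [psi], all dividing over [A]. *)
  apply: contrapT => /forallNP noa; apply: (Jnf m).
  pose P := [pred k | `[< isDiv (c k) >]].
  have divP (k : 'I_#|P|) : isDiv (c (enum_val k)).
    by apply/asboolP; exact: (enum_valP k).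
  pose psi k := projT1 (cid (divP k)).
  have psiP k := projT2 (cid (divP k)).
  exists #|P|, (fun k => projT1 (c (enum_val k))), psi,
    (fun k => (projT2 (c (enum_val k))).1.2); split=> [k|q gq qJ].
    by have [] := psiP k.
  apply: contrapT => /forallNP qpsi.
  have [F FF Fq] := global_type_filter gq.
  (* Each condition holds on a set of the filter converging to [q]: one of the dividing kind because
     [q] makes no [psi] true, an average one because [q] extends the type of [J m]. *)
  suff /filter_ex[a aP] : F [set a | forall k, solutions (c k) a] by exact: (noa a).
  apply: filter_forall => k.
  have [isd|nisd] := pselect (isDiv (c k)).
    have kP : k \in P by exact/asboolP.
    pose l := enum_rank_in kP k.
    have -> : k = enum_val l by rewrite enum_rankK_in.
    have Fpsi : F [set a | eval (psi l)
        (env_cat a (projT2 (c (enum_val l))).1.2) <> true_value C].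
      exact: Fq _ _ _ _ (nbhs_not_true (qpsi l)).
    apply: filterS Fpsi => a psia; apply: contrapT => na; apply: psia.
    by have [_ /(_ a na)] := psiP l.
  have [isa|//] := Dc k; have [bA nU] := isa.
  have bm y : A (coord (projT2 (c k)).1.2 y) \/ exists i x,
      (i < m)%O /\ coord (projT2 (c k)).1.2 y = coord (J i) x.
    have [Ay|[i [x [im E]]]] := mkP k isa y; [by left|right].
    by exists i, x; split=> //; exact: lt_trans im (mkm k).
  apply: (Fq _ _ _ (projT2 (c k)).2); rewrite qJ.
    rewrite /tp -(Av_eval tameC endlessO Jind _ bm (lexx _)); exact: nU.
  move=> y; have [Ay|[i [x [im E]]]] := bm y; [by left|right].
  by exists i, x.
have [F [FU F0F]] := ultraFilterLemma FF0.
(* Along an ultrafilter every formula has a limit, so all values of [p] are genuine limits. *)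
pose p : pretype X := fun Z chi e => lim ((fun a => eval chi (env_cat a e)) @ F).
have Fp Z chi e : (fun a => eval chi (env_cat a e)) @ F --> p Z chi e.
  exact: tame_ultra tameC _ _ FU _ _ (fun a => env_cat a e).
exists p; split.
- exact: (limit_complete_type (F := F) (a := id)).
- move=> Y phi b bA.
  have FAv : (fun a => eval phi (env_cat a b)) @ F --> Av J phi b.
    move=> U nU; apply: F0F.
    by apply: (F0D (existT _ Y (phi, b, U))); left.
  exact: (@cvg_unique _ (tame_hausdorff tameC) _ _ _ _ (Fp Y phi b) FAv).
(* The condition that [phi] stays outside [N] is among those in [F], since elements violating it
   satisfy the dividing [psi]. *)
- move=> Y phi b /divides_approx[psi [psid [N nN NP]]] pT.
  have FN : F [set a | N (eval phi (env_cat a b))].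
    by apply: (Fp Y phi b); rewrite pT.
  have FNC : F [set a | ~ N (eval phi (env_cat a b))].
    apply/F0F/(F0D (existT _ Y (phi, b, ~` N))); right; exists psi; split=> // a.
    by rewrite /solutions /= => /contrapT; exact: NP.
  by have [a []] := filter_ex (filterI FN FNC).
Qed.

End Existence.

(** * Classical monster models *)

(** The sorts of [x] and [m x] are not convertible, so values are compared as dependent pairs. *)
Definition same_values (S : Type) (E : S -> Type) (X Y : ctx S) (m : X -> Y)
    (a : env E X) (b : env E Y) : Prop :=
  forall x, existT E (csort x) (a x) = existT E (csort (m x)) (b (m x)).

Definition ctx_add_map (S : Type) (s : S) (X Y : ctx S) (m : X -> Y) :
    ctx_add s X -> ctx_add s Y := omap m.

Lemma same_values_add (S : Type) (E : S -> Type) (s : S) (X Y : ctx S)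
    (m : X -> Y) (e : E s) (a : env E X) (b : env E Y) :
  same_values m a b -> same_values (@ctx_add_map _ s _ _ m) (env_add e a) (env_add e b).
Proof. by move=> ab [x|] //=; exact: ab. Qed.

Lemma term_rename (L : language) (E : lsort L -> Type)
    (fi : forall f : lfun L, env E (fdom f) -> E (fcod f))
    (X Y : ctx (lsort L)) (m : X -> Y) (s : lsort L) (t : term X s) :
  (forall x, csort (m x) = csort x) ->
  exists u : term Y s, forall (a : env E X) (b : env E Y), same_values m a b ->
    term_eval fi b u = term_eval fi a t.
Proof.
move=> mE; elim: t => [x|f t IH].
  suff [u uP] : exists u : term Y (csort x), forall b : env E Y,
      existT E (csort x) (term_eval fi b u) = existT E (csort (m x)) (b (m x)).
    exists u => a b ab; apply: (@existT_inj2 {classic lsort L}).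
    by rewrite uP ab.
  by rewrite -(mE x); exists (Var (m x)).
have uP i := cid (IH i).
exists (App (fun i => projT1 (uP i))) => a b ab /=.
congr (fi f _); apply: functional_extensionality_dep => i.
exact: (projT2 (uP i) a b ab).
Qed.

Lemma env_add_map (S : Type) (E : S -> Type) (g : forall s, E s -> E s) (s : S)
    (X : ctx S) (e : E s) (a : env E X) :
  (fun x => g _ (env_add e a x)) = env_add (g s e) (fun x => g _ (a x)).
Proof. by apply: functional_extensionality_dep; case. Qed.

Section Automorphisms.
Variables (L : language) (V : Type) (E : lsort L -> Type).
Variables (fi : forall f : lfun L, env E (fdom f) -> E (fcod f)).
Variables (ri : forall r : lrel L, env E (rdom r) -> V).

Lemma term_eval_map (g : forall s, E s -> E s) (X : ctx (lsort L))
    (a : env E X) (s : lsort L) (t : term X s) :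
  preserves_symbols fi ri g ->
  term_eval fi (fun x => g _ (a x)) t = g s (term_eval fi a t).
Proof.
move=> [_ gf _]; elim: t => //= f t IH; rewrite gf; congr (@fi f _).
by apply: functional_extensionality_dep => i; exact: IH.
Qed.

Lemma preserves_symbols_inverse (g : forall s, E s -> E s) :
  preserves_symbols fi ri g -> exists g' : forall s, E s -> E s,
    (forall s, cancel (g s) (g' s)) /\ (forall s, cancel (g' s) (g s)).
Proof.
move=> [gbij _ _].
have gP s : exists h, cancel (g s) h /\ cancel h (g s).
  by case: (gbij s) => h ? ?; exists h.
exists (fun s => projT1 (cid (gP s))).
by split=> s; have [] := projT2 (cid (gP s)).
Qed.

End Automorphisms.

Section Classical.
Variables (L : language) (M : structure L).

Lemma formula_rename (X Y : ctx (lsort L)) (phi : formula X) (m : X -> Y) :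
  (forall x, csort (m x) = csort x) ->
  exists psi : formula Y, forall (a : env (@carrier L M) X) (b : env (@carrier L M) Y),
    same_values m a b -> feval psi b = feval phi a.
Proof.
elim: phi Y m => {X} [X r t|X s t u||X phi IH1 psi IH2|X s phi IH] Y m mE.
- have tP i := cid (term_rename (@fint L M) (t i) mE).
  exists (FRel (fun i => projT1 (tP i))) => a b ab /=; congr (rint _).
  by apply: functional_extensionality_dep => i; exact: (projT2 (tP i)).
- have [t' t'P] := term_rename (@fint L M) t mE.
  have [u' u'P] := term_rename (@fint L M) u mE.
  by exists (FEq t' u') => a b ab /=; rewrite (t'P a) // (u'P a).
- by exists FBot.
- have [phi' phi'P] := IH1 _ _ mE; have [psi' psi'P] := IH2 _ _ mE.
  by exists (FImp phi' psi') => a b ab /=; rewrite (phi'P a) // (psi'P a).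
- have [|phi' phi'P] := IH (ctx_add s Y) (@ctx_add_map _ s _ _ m).
    by case.
  exists (FAll phi') => a b ab /=; apply: asbool_equiv_eq.
  by split=> H e; [rewrite -(phi'P (env_add e a) (env_add e b))|
    rewrite (phi'P (env_add e a) (env_add e b))] => //; exact: same_values_add.
Qed.

Lemma feval_automorphism (g : forall s, carrier M s -> carrier M s)
    (X : ctx (lsort L)) (phi : formula X) (a : env (@carrier L M) X) :
  automorphism g -> feval phi (fun x => g _ (a x)) = feval phi a.
Proof.
move=> gaut; have [gbij gf gr] := gaut.
elim: phi a => {X} [X r t|X s t u||X phi IH1 psi IH2|X s phi IH] a //=.
- rewrite -[RHS]gr; congr (rint _); apply: functional_extensionality_dep => i.
  exact: (term_eval_map _ _ gaut).
- apply: asbool_equiv_eq; rewrite !(term_eval_map _ _ gaut).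
  by split=> [/(bij_inj (gbij _))|->].
- by rewrite IH1 IH2.
- apply: asbool_equiv_eq; split=> H e.
    by rewrite -IH env_add_map.
  (* Surjectivity of [g] lets the quantifier range over images only. *)
  by have [g' gK g'K] := gbij s; rewrite -(g'K e) -env_add_map IH.
Qed.

Lemma classical_tame (K : Type) :
  small K [set: nat] -> saturated K (classical M) ->
  @homogeneous K (classical M) (@automorphism L M) -> tame K (classical M).
Proof.
move=> Knat sat hom; split=> //.
- by move=> X Y phi m mE; exact: formula_rename.
- move=> s; pose X := ctx_cat (ctx1 s) (ctx1 s).
  exists (FEq (@Var L X (inl tt)) (@Var L X (inr tt))) => e e' e'' /=.
  by rewrite asboolT // => /esym /asboolP.
- move=> B f Bsmall fB; have [g gaut gf] := hom B f Bsmall fB.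
  have [g' [gK g'K]] := preserves_symbols_inverse gaut.
  by exists g, g'; split=> // X phi a _; exact: feval_automorphism.
- exact: discrete_hausdorff.
(* An ultrafilter decides whether [phi] holds, so the values are eventually constant. *)
- move=> T F FU X phi a.
  have [Ft|Ff] := in_ultra_setVsetC [set t | feval phi (a t)] FU.
    apply: cvgP; apply: (cvg_near_cst true); apply: filterS Ft => t /= ->; by [].
  apply: cvgP; apply: (cvg_near_cst false); apply: filterS Ff => t /= /negP/negbTE; by [].
- move=> v w vw; exists (fun z : bool * bool => (z.1 == v) && (z.2 == w)); split.
  + move=> [x y] U /nbhs_singleton U0.
    exists ([set x], [set y]); first by split; exact: discrete_set1.
    by move=> [_ _] [/= -> ->].
  + by rewrite /= !eqxx.
  + by move=> l /= /andP[/eqP-> /eqP].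
  + move=> X phi phi'.
    (* The conjunction of two literals, written with implication and falsity. *)
    pose lit (u : bool) (chi : formula X) := if u then chi else FImp chi FBot.
    have litE u chi a : feval (lit u chi) a = (@feval L M X chi a == u).
      by case: u => /=; [rewrite eqb_id|rewrite implybF eqbF_neg].
    exists (FImp (FImp (lit v phi) (FImp (lit w phi') FBot)) FBot) => a /=.
    by rewrite !litE !implybF negb_imply negbK.
- move=> X phi; exists (fun=> phi); split.
    by move=> n; exists [set true] => [|a ->//]; exact: discrete_set1.
  move=> U nU; exists 0%N => m _ a /= ->; exact: nbhs_singleton nU.
Qed.

End Classical.

(** * Continuous monster models *)

Lemma ultra_fmap (T U : Type) (f : T -> U) (F : set_system T) :
  UltraFilter F -> UltraFilter (f @ F).
Proof.
move=> FU; split=> [|G PG FG]; first exact: fmap_proper_filter.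
apply/seteqP; split=> // B GB; have [//|FnB] := in_ultra_setVsetC (f @^-1` B) FU.
have GnB : G (~` B) by exact: FG.
by have [x []] := filter_ex (filterI GB GnB).
Qed.

Section Continuous.
Local Open Scope ring_scope.
Variables (R : realType) (L : metric_language R) (M : metric_structure L).
Local Notation tuple X := (env (fun s => mcarrier M s : Type) X).

Lemma mformula_rename (X Y : ctx (lsort L)) (phi : mformula X) (m : X -> Y) :
  (forall x, csort (m x) = csort x) ->
  exists psi : mformula Y, forall (a : tuple X) (b : tuple Y),
    same_values m a b -> mfeval psi b = mfeval phi a.
Proof.
elim: phi Y m => {X} [X r t|X s t u|X n u hu phi IH|X s phi IH|X s phi IH] Y m mE.
- have tP i := cid (term_rename (@mfint R L M) (t i) mE).
  exists (MRel (fun i => projT1 (tP i))) => a b ab /=; congr (mrint _).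
  by apply: functional_extensionality_dep => i; exact: (projT2 (tP i)).
- have [t' t'P] := term_rename (@mfint R L M) t mE.
  have [u' u'P] := term_rename (@mfint R L M) u mE.
  by exists (MDist t' u') => a b ab /=; rewrite (t'P a) // (u'P a).
- have phiP i := cid (IH i _ _ mE).
  exists (MConn hu (fun i => projT1 (phiP i))) => a b ab /=; congr u.
  by apply/rowP => i; rewrite !mxE (projT2 (phiP i) a).
- have [|phi' phi'P] := IH (ctx_add s Y) (@ctx_add_map _ s _ _ m); first by case.
  exists (MSup phi') => a b ab /=; congr (sup _); apply: eq_imagel => e _.
  by apply: phi'P; exact: same_values_add.
- have [|phi' phi'P] := IH (ctx_add s Y) (@ctx_add_map _ s _ _ m); first by case.
  exists (MInf phi') => a b ab /=; congr (inf _); apply: eq_imagel => e _.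
  by apply: phi'P; exact: same_values_add.
Qed.

Lemma mfeval_automorphism (g : forall s, mcarrier M s -> mcarrier M s)
    (X : ctx (lsort L)) (phi : mformula X) (a : tuple X) :
  @mautomorphism R L M g -> mfeval phi ((fun x => g _ (a x)) : tuple X) = mfeval phi a.
Proof.
move=> [gaut gdist]; have [gbij gf gr] := gaut.
elim: phi a => {X} [X r t|X s t u|X n u hu phi IH|X s phi IH|X s phi IH] a /=.
- rewrite -[RHS]gr; congr (mrint _); apply: functional_extensionality_dep => i.
  exact: (term_eval_map _ _ gaut).
- by rewrite !(term_eval_map _ _ gaut) gdist.
- by congr u; apply/rowP => i; rewrite !mxE IH.
- congr (sup _); apply/seteqP; split=> [_ [e _ <-]|_ [e _ <-]]; last first.
    by exists (g s e) => //; rewrite -[RHS]IH env_add_map.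
  have [g' gK g'K] := gbij s; exists (g' e) => //.
  by rewrite -[LHS]IH env_add_map g'K.
- congr (inf _); apply/seteqP; split=> [_ [e _ <-]|_ [e _ <-]]; last first.
    by exists (g s e) => //; rewrite -[RHS]IH env_add_map.
  have [g' gK g'K] := gbij s; exists (g' e) => //.
  by rewrite -[LHS]IH env_add_map g'K.
Qed.

(** Sorts are inhabited, so suprema and infima are taken over nonempty bounded sets. *)
Lemma mfeval_itv (X : ctx (lsort L)) (phi : mformula X) (a : tuple X) :
  0 <= mfeval phi a <= 1.
Proof.
elim: phi a => {X} [X r t|X s t u|X n u hu phi IH|X s phi IH|X s phi IH] a /=.
- exact: mrint_bounded.
- by rewrite mdist_ge0 mcarrier_bounded.
- by apply: hu.2 => i; rewrite mxE.
- have [e0] := mcarrier_inhabited M s.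
  have ne : [set mfeval phi (env_add e a) | e in [set: mcarrier M s]] !=set0.
    by exists (mfeval phi (env_add e0 a)); exists e0.
  have ub1 : ubound [set mfeval phi (env_add e a) | e in [set: mcarrier M s]] 1.
    by move=> _ [e _ <-]; have /andP[] := IH (env_add e a).
  apply/andP; split; last exact: ge_sup.
  have /andP[e0_ge0 _] := IH (env_add e0 a); apply: le_trans e0_ge0 _.
  by apply: ub_le_sup; [exists 1|exists e0].
- have [e0] := mcarrier_inhabited M s.
  have ne : [set mfeval phi (env_add e a) | e in [set: mcarrier M s]] !=set0.
    by exists (mfeval phi (env_add e0 a)); exists e0.
  have lb0 : lbound [set mfeval phi (env_add e a) | e in [set: mcarrier M s]] 0.
    by move=> _ [e _ <-]; have /andP[] := IH (env_add e a).
  apply/andP; split; first exact: lb_le_inf.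
  have /andP[_ e0_le1] := IH (env_add e0 a); apply: le_trans e0_le1.
  by apply: ge_inf; [exists 0|exists e0].
Qed.

Lemma connective_cutoff (n : nat) (u : 'rV[R]_n -> R) :
  continuous u -> (forall v, unit_cube v -> u v <= 1) -> connective (fun v => Num.max 0 (u v)).
Proof.
move=> uc u1; split=> [|v /u1 uv]; last by rewrite le_max lexx ge_max ler01 uv.
apply: continuous_subspaceT => v; apply: (@continuous_max _ _ (cst 0) u v).
  exact: cst_continuous.
exact: uc.
Qed.

(** For [v <> w], the value is 0, hence true, exactly at pairs at least as far apart as [v] and [w],
    and it is 1 on the diagonal. *)
Definition separation (v w : R) (z : R * R) : R :=
  Num.max 0 (1 - `|z.1 - z.2| / `|v - w|).

Lemma separation_continuous v w : continuous (separation v w).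
Proof.
move=> z; apply: (@continuous_max _ _ (cst 0) (fun z => 1 - `|z.1 - z.2| / `|v - w|) z).
  exact: cst_continuous.
apply: cvgB; first exact: cvg_cst.
apply: cvgM; last exact: cvg_cst.
by apply: cvg_norm; apply: cvgB; [exact: cvg_fst|exact: cvg_snd].
Qed.

Lemma continuous_tame (K : Type) :
  small K [set: nat] -> saturated K (continuous_semantics M) ->
  @homogeneous K (continuous_semantics M) (@mautomorphism R L M) ->
  tame K (continuous_semantics M).
Proof.
move=> Knat sat hom; split=> //.
- by move=> X Y phi m mE; exact: mformula_rename.
- move=> s; pose X : ctx (lsort L) := ctx_cat (ctx1 s) (ctx1 s).
  exists (MDist (@Var L X (inl tt)) (@Var L X (inr tt))) => e e' e'' /=.
  by rewrite mdistxx => /esym /mdist_positivity.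
- move=> B f Bsmall fB; have [g gaut gf] := hom B f Bsmall fB.
  have [g' [gK g'K]] := preserves_symbols_inverse gaut.1.
  by exists g, g'; split=> // X phi a _; exact: mfeval_automorphism.
- move=> T F FU X phi a.
  (* Formulas take values in the compact unit interval, where ultrafilters converge. *)
  have := @segment_compact R 0 1; rewrite compact_ultra.
  move=> /(_ _ (ultra_fmap (fun t => mfeval phi (a t)) FU))[|l [_ Fl]].
    apply: (@filterE _ F) => t /=; rewrite in_itv /=; exact: mfeval_itv.
  by apply/cvg_ex; exists l.
- move=> v w /eqP vw; exists (separation v w); split.
  + exact: separation_continuous.
  + by rewrite /separation /= divff ?subrr ?maxxx // normr_eq0 subr_eq0.
  + move=> l; rewrite /separation /= subrr normr0 mul0r subr0.
    by rewrite max_r ?ler01 //; apply/eqP; exact: oner_neq0.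
  + move=> X phi phi'.
    have uc : connective (fun r : 'rV[R]_2 =>
        Num.max 0 (1 - `|r ord0 ord0 - r ord0 (lift ord0 ord0)| / `|v - w|)).
      apply: connective_cutoff => [r|r _]; last by rewrite gerBl divr_ge0.
      have rc : (fun r : 'rV[R]_2 => r ord0 ord0 - r ord0 (lift ord0 ord0)) @ r -->
          r ord0 ord0 - r ord0 (lift ord0 ord0).
        exact: (cvgB (@coord_continuous R 1 2 ord0 ord0 r)
          (@coord_continuous R 1 2 ord0 (lift ord0 ord0) r)).
      exact: (cvgB (cvg_cst _) (cvgM (cvg_norm rc) (cvg_cst _))).
    exists (MConn uc (fun i => if i == ord0 then phi else phi')) => a /=.
    by rewrite !mxE /separation.
- move=> X phi.
  have uc n : connective (fun r : 'rV[R]_1 => Num.max 0 (r ord0 ord0 - n.+1%:R^-1)).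
    apply: connective_cutoff => [r|r r01].
      exact: (cvgB (@coord_continuous R 1 1 ord0 ord0 r) (cvg_cst _)).
    have /andP[_ r1] := r01 ord0.
    by rewrite lerBlDr (le_trans r1) // lerDl invr_ge0.
  exists (fun n => MConn (uc n) (fun=> phi)); split=> [n|U].
    exists [set x | x < n.+1%:R^-1] => [|a /= an].
      by apply: lt_nbhsl; rewrite invr_gt0.
    by rewrite mxE max_l // subr_le0 ltW.
  move=> /nbhs_ballP[e e0 eU].
  (* Truth of the approximation with index [m] bounds [phi] by [1/(m+1)], which is less than [e]
     from [n] on. *)
  have [n _ nP] := near_infty_natSinv_lt (PosNum e0).
  exists n => m nm a /= am; apply: eU; have /andP[a0 _] := mfeval_itv phi a.
  rewrite /ball /= sub0r normrN ger0_norm //; apply: le_lt_trans (nP m nm).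
  by rewrite -subr_le0 -[leRHS]am mxE le_max lexx orbT.
Qed.

End Continuous.

(** * Uniqueness and existence of the nonforking extension in monster models *)

Theorem lemma2p8 (R : realType) (K : Type) (C : semantics)
    (C_monster : monster_model R K C)
    (T_eq : has_canonical_parameters C)
    (T_dependent : dependent K C)
    (A : set (element (@elt C))) (A_small : small K A) :
  (forall (d : Order.disp_t) (O : orderType d) (X : ctx (esort C))
          (I : O -> env (@elt C) X) (p q : pretype X),
     endless O -> small K (entries I setT) -> indiscernible A I ->
     global_type p -> global_type q ->
     agree_on (A `|` entries I setT) p (Av I) ->
     agree_on (A `|` entries I setT) q (Av I) ->
     ~ forks A setT p -> ~ forks A setT q ->
     p = q) /\
  (forall (d : Order.disp_t) (O : orderType d) (X : ctx (esort C))
          (I : O -> env (@elt C) X),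
     endless O -> small K (entries I setT) -> Morley_sequence A I ->
     exists! p : pretype X,
       [/\ global_type p,
           agree_on (A `|` entries I setT) p (Av I)
         & ~ forks A setT p]).
Proof.
have tameC : tame K C.
  case: C_monster => [L T M [Knat _ _ _] _ _|L T M [Knat _ _ _] _ _].
    exact: classical_tame.
  exact: continuous_tame.
split=> [d O X I p q endlessO Ismall Iind|d O X I endlessO Ismall IMorley].
  move=> gp gq pAv qAv /nonforking_avoids_dividing ap /nonforking_avoids_dividing aq.
  exact: (nonforking_extension_unique tameC T_dependent endlessO Iind A_small Ismall).
have [p [gp pAv ap]] := nonforking_extension_exists tameC endlessO IMorley.
exists p; split; first by split=> //; exact: avoids_dividing_nonforking.
(* A Morley sequence is in particular [A]-indiscernible, so the argument for uniqueness applies to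
   it. *)
move=> q [gq qAv /nonforking_avoids_dividing aq]; case: IMorley => Iind _.
exact: (nonforking_extension_unique tameC T_dependent endlessO Iind A_small Ismall).
Qed.
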